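(* For all complex $q$ with $|q|<1$: $$\mathcal{Q}(q)=\varphi^8(-q),$$ $$16q\psi^4(q^2)+\varphi^4(q)=\mathcal{E}(q),$$ $$2\mathcal{E}(q^2)+\mathcal{E}(q)=3\varphi^4(q),$$ $$\varphi^4(q)\mathcal{E}(q)+\mathcal{Q}(q^2)=2\varphi^8(q),$$ $$\mathcal{E}(q)-\mathcal{E}(q^2)=24q\psi^4(q^2),$$ $$\mathcal{P}(q)-\mathcal{P}(-q)=16q\psi^4(q^2),$$ $$\mathcal{Q}(q)-\mathcal{Q}(-q)=32q\big(8q\psi^8(q^2)-\psi^8(q)\big),$$ $$\mathcal{E}^2(q)-\mathcal{Q}(q)=64q\psi^8(q).$$
   Context: For $s,n\in\mathbb{N}$ (positive integers), $\widetilde{\sigma}_s(n)=\sum_{d\mid n}(-1)^{d-1}d^s$ and $\widehat{\sigma}_s(n)=\sum_{d\mid n}(-1)^{\frac nd-1}d^s$; write $\widetilde{\sigma}=\widetilde{\sigma}_1$, $\widehat{\sigma}=\widehat{\sigma}_1$. For $|q|<1$, $$\mathcal{P}(q)=1+8\sum_{n=1}^\infty\widetilde{\sigma}(n)q^n,\quad \mathcal{E}(q)=1+24\sum_{n=1}^\infty\widehat{\sigma}(n)q^n,\quad \mathcal{Q}(q)=1-16\sum_{n=1}^\infty\widetilde{\sigma}_3(n)q^n,$$ and Ramanujan's theta functions are $$\varphi(q)=\sum_{n=-\infty}^\infty q^{n^2},\qquad \psi(q)=\sum_{n=0}^\infty q^{n(n+1)/2}.$$ Here $\varphi^k(q)$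 means $(\varphi(q))^k$, and similarly for the other functions. *)

(* Defs.v *)
From mathcomp Require Import all_boot all_order all_algebra.
From mathcomp Require Import boolp classical_sets topology normedtype.
From mathcomp Require Import sequences.

Set Implicit Arguments.
Unset Strict Implicit.
Unset Printing Implicit Defensive.

Import Order.TTheory GRing.Theory Num.Theory.
Import numFieldNormedType.Exports.

Local Open Scope ring_scope.

Definition sigma_tilde (s n : nat) : int :=
  \sum_(d <- divisors n) (-1) ^+ d.-1 * d%:Z ^+ s.

Definition sigma_hat (s n : nat) : int :=
  \sum_(d <- divisors n) (-1) ^+ (n %/ d).-1 * d%:Z ^+ s.

Section Series.
Variable K : numFieldType.
Implicit Types q : K.

(* Limits are taken in the topology of the norm of K. The intended K is the
   field R[i] over a realType R, where every series below converges as soon as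
   `|q| < 1, so that the default value of lim is never used. *)

Definition calP q : K :=
  1 + 8 * \big[+%R/0]_(1 <= n <oo) ((sigma_tilde 1 n)%:~R * q ^+ n).

Definition calE q : K :=
  1 + 24 * \big[+%R/0]_(1 <= n <oo) ((sigma_hat 1 n)%:~R * q ^+ n).

Definition calQ q : K :=
  1 - 16 * \big[+%R/0]_(1 <= n <oo) ((sigma_tilde 3 n)%:~R * q ^+ n).

(* Sum over all integers: int is the disjoint union of the n = Posz n >= 0
   and the -(n + 1) = Negz n < 0. *)
Definition bilateral_sum (u : int -> K) : K :=
  \big[+%R/0]_(0 <= n <oo) (u (Posz n)) +
  \big[+%R/0]_(0 <= n <oo) (u (Negz n)).

Definition varphi q : K := bilateral_sum (fun n : int => q ^ (n ^+ 2)).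

Definition psi q : K :=
  \big[+%R/0]_(0 <= n <oo) (q ^+ ((n * n.+1) %/ 2)).

End Series.

(* Main.v *)
Require Import Defs.
From mathcomp Require Import all_boot all_order all_algebra complex.
From mathcomp Require Import boolp classical_sets functions cardinality fsbigop.
From mathcomp Require Import reals topology normedtype sequences.
From mathcomp Require Import zify ring lra.
Set Implicit Arguments.
Unset Strict Implicit.
Unset Printing Implicit Defensive.
Import Order.TTheory GRing.Theory Num.Theory.
Import numFieldNormedType.Exports.
Local Open Scope classical_set_scope.
Local Open Scope ring_scope.

(** Write [a = varphi q ^+ 4] and [b = varphi (- q) ^+ 4]. The eight identities
    are algebraic consequences of two expansions into divisor sums and of a few
    relations between theta functions.

    The first expansion is Jacobi's four-square theorem: [b] is
    [1 - 8 \sum_n tau n q^n], where [tau n] is the sum of [(-1)^(d + e) d] over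
    the factorizations [n = d e]. Logarithmic differentiation of
    [varphi (- q) ^+ 4] shows that its coefficients are the only solution, with
    constant term 1, of a linear recurrence ([power_from_recurrence]). That the
    divisor sums satisfy this recurrence ([four_square_recurrence]) is an
    identity between sums over the solutions of [i^2 + d e = n]. It is proved in
    the manner of Liouville ([liouville_square]): explicit bijections between
    parts of the solution set cancel everything except the solutions with
    [e = 2 i + d], for which [n] is the square of [i + d].

    The second expansion is the eight-square theorem, [calQ q = b ^+ 2].
    Expanding the square of [1 - 8 \sum_n tau n q^n], it becomes an evaluation
    of the convolution of [tau] with itself ([conv_tau]), obtained by a similar
    argument on the solutions of [a x + b y = n].

    Comparing divisor sums at [n] and [2 n] then gives [calE q = 2 a - b],
    [calE q + calE (- q) = 2 calE (q^2)] and [calP q - calP (- q) = a - b].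

    For the theta functions, the parity of the summation index gives
    [varphi q = varphi (q^4) + 2 q psi (q^8)], and the equality of the numbers
    of representations of [n] and of [2 n] as a sum of two squares gives
    [varphi q ^+ 2 + varphi (- q) ^+ 2 = 2 varphi (q^2) ^+ 2]. These two alone
    imply [psi q ^+ 2 = varphi q * psi (q^2)],
    [varphi q * varphi (- q) = varphi (- q^2) ^+ 2] and
    [a - b = 16 q psi (q^2) ^+ 4]; the conclusion is [eight_identities].

    The passage from coefficients to functions uses power series with integer
    coefficients that converge absolutely in the unit disk; their evaluation
    turns convolution into multiplication ([gf_conv]). *)

(** * Signs and finitely supported sums *)

Definition altsign (x : int) : int := (-1) ^+ `|x|%N.

Lemma altsignD x y : altsign (x + y) = altsign x * altsign y.
Proof.
rewrite /altsign -exprD -signr_odd -[RHS]signr_odd; congr (_ ^+ nat_of_bool _).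
lia.
Qed.

Lemma altsignN x : altsign (- x) = altsign x.
Proof. by rewrite /altsign abszN. Qed.

(** Stated with an explicit half-difference so that signs are compared by
    solving a linear equation. *)
Lemma altsign_mod2 x y k : x = y + 2 * k -> altsign x = altsign y.
Proof.
move=> ->; rewrite altsignD [X in _ * X](_ : _ = 1) ?mulr1//.
by rewrite /altsign -signr_odd (_ : odd _ = false)//; lia.
Qed.

Lemma altsign_sqr x : altsign x * altsign x = 1.
Proof. by rewrite -expr2 sqrr_sign. Qed.

Lemma finite_int_box (M : int) : finite_set [set x : int | `|x| <= M].
Proof.
have: finite_set ((fun n : nat => n%:Z) @` `I_(`|M|.+1) `|`
                  (fun n : nat => - n%:Z) @` `I_(`|M|.+1)).
  by rewrite finite_setU; split; apply: finite_image; exact: finite_II.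
apply: sub_finite_set => x /= xM.
by have [x0|x0] := leP 0 x; [left|right]; exists `|x|%N => /=; lia.
Qed.

Lemma fsbig_partition (T : choiceType) (A : set T) (k : T -> nat) (N : nat)
    (F : T -> int) : finite_set A -> (forall t, A t -> (k t < N)%N) ->
  \sum_(t \in A) F t = \sum_(i < N) \sum_(t \in A `&` [set t | k t = i]) F t.
Proof.
move=> finA kN; under [RHS]eq_bigr => i _.
  rewrite fsbig_mkcondr fsbig_finite//; over.
rewrite fsbig_finite// exchange_big/= [LHS]big_seq [RHS]big_seq.
apply: eq_bigr => t; rewrite in_fset_set// inE => /kN ktN.
rewrite (bigD1 (Ordinal ktN))//= mem_set// big1 ?addr0// => i; rewrite -val_eqE/=.
by move=> ikt; rewrite memNset//= => kti; rewrite kti eqxx in ikt.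
Qed.

(** Change of variables with an explicit inverse, which turns the bijectivity
    into two families of equations. *)
Lemma fsbig_bij (T U : choiceType) (A : set T) (B : set U) (f : T -> U)
    (g : U -> T) (F : T -> int) (G : U -> int) :
  (forall t, A t -> [/\ B (f t), g (f t) = t & G (f t) = F t]) ->
  (forall u, B u -> A (g u) /\ f (g u) = u) ->
  \sum_(t \in A) F t = \sum_(u \in B) G u.
Proof.
move=> fP gP; rewrite (@reindex_fsbig _ _ _ _ _ f A).
  by apply: eq_fsbigr => t /set_mem /fP[].
split=> [t /fP[]//|t u /set_mem /fP[_ tE _] /set_mem /fP[_ uE _] tu|u /gP[Ag fg]].
  by rewrite -tE tu uE.
by exists (g u).
Qed.

Lemma fsbig_trichotomy (T : choiceType) (A : set T) (k : T -> int)
    (F : T -> int) : finite_set A ->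
  \sum_(t \in A) F t = \sum_(t \in A `&` [set t | k t < 0]) F t +
    \sum_(t \in A `&` [set t | k t = 0]) F t +
    \sum_(t \in A `&` [set t | 0 < k t]) F t.
Proof.
move=> finA; rewrite (fsbigID [set t | k t < 0])//= -addrA; congr (_ + _).
rewrite (fsbigID [set t | k t = 0])/=; last exact: finite_setIl.
by congr (_ + _); apply: eq_fsbigl; rewrite -setIA; congr (_ `&` _);
  apply/seteqP; split=> t /=; lia.
Qed.

Lemma fsbigD (T : choiceType) (A : set T) (F G : T -> int) : finite_set A ->
  \sum_(t \in A) (F t + G t) = \sum_(t \in A) F t + \sum_(t \in A) G t.
Proof. exact: fsbig_split. Qed.

Lemma fsbigN (T : choiceType) (A : set T) (F : T -> int) :
  \sum_(t \in A) - F t = - \sum_(t \in A) F t.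
Proof.
rewrite -mulN1r mulr_fsumr; apply: eq_fsbigr => t _; by rewrite mulN1r.
Qed.

Lemma fsbig_sign_reversing (T : choiceType) (A : set T) (f : T -> T)
    (F : T -> int) :
  (forall t, A t -> [/\ A (f t), f (f t) = t & F (f t) = - F t]) ->
  \sum_(t \in A) F t = 0.
Proof.
move=> fP; suff e : \sum_(t \in A) F t = - \sum_(t \in A) F t by lia.
rewrite -fsbigN; apply: (fsbig_bij (f := f) (g := f)) => t /fP[Af ff Ff]; split=> //.
by rewrite Ff opprK.
Qed.

(** * Coefficients of generating series and their convolution *)

(** The coefficient of [q^n] in [\sum_(t in A) w t q^(deg t)]. All counting
    functions below have this form, so that products of series become sums over
    product sets by [conv_fiber_sum]. *)
Definition fiber_sum (T : choiceType) (A : set T) (deg w : T -> int) (n : nat) : int :=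
  \sum_(t \in A `&` [set t | deg t = n%:Z]) w t.

Definition conv (a b : nat -> int) (n : nat) : int :=
  \sum_(i < n.+1) a i * b (n - i)%N.

Definition finite_fibers (T : choiceType) (A : set T) (deg : T -> int) :=
  (forall t, A t -> 0 <= deg t) /\
  forall n : nat, finite_set (A `&` [set t | deg t = n%:Z]).

Lemma finite_fibersX (T U : choiceType) (A : set T) (B : set U) degA degB :
  finite_fibers A degA -> finite_fibers B degB ->
  finite_fibers (A `*` B) (fun p => degA p.1 + degB p.2).
Proof.
move=> [A0 finA] [B0 finB]; split=> [[t u] [/= /A0 t0 /B0 u0]|n].
  exact: addr_ge0.
have fin_le C (V : choiceType) (X : set V) dg :
    (forall n : nat, finite_set (X `&` [set t | dg t = n%:Z])) ->
    finite_set (X `&` [set t | 0 <= dg t < C%:Z]).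
  move=> finX; apply: (@sub_finite_set _ _ (\bigcup_(i in `I_C) (X `&` [set t | dg t = i%:Z]))).
    by move=> t [/= Xt dt]; exists `|dg t|%N => /=; [|split=> //]; lia.
  by apply: bigcup_finite => //; exact: finite_II.
apply: (sub_finite_set _ (finite_setX (fin_le n.+1 _ _ _ finA) (fin_le n.+1 _ _ _ finB))).
move=> [t u] [[/= At Bu]] tu; have := A0 _ At; have := B0 _ Bu.
by move=> ? ?; split; split=> //=; lia.
Qed.

Lemma conv_fiber_sum (T U : choiceType) (A : set T) (B : set U) degA degB wA wB :
  finite_fibers A degA -> finite_fibers B degB ->
  conv (fiber_sum A degA wA) (fiber_sum B degB wB) =1
  fiber_sum (A `*` B) (fun p => degA p.1 + degB p.2) (fun p => wA p.1 * wB p.2).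
Proof.
move=> fA fB n; have [_ fAB] := finite_fibersX fA fB.
move: fA fB => [A0 finA] [B0 finB].
rewrite /conv /fiber_sum [RHS](@fsbig_partition _ _ (fun p => `|degA p.1|%N) n.+1)//; last first.
  by move=> [t u] [[/= /A0 t0 /B0 u0]]; lia.
apply: eq_bigr => i _; rewrite mulr_fsuml.
under eq_fsbigr do rewrite mulr_fsumr.
rewrite pair_fsbig//; apply: eq_fsbigl; apply/seteqP; have := ltn_ord i.
split=> [[t u]|[t u]] /=.
  by move=> [[At ti] [Bu ui]]; split; [split=> //|]; lia.
by move=> [[[At Bu] tu] ti]; have := A0 _ At; split; split=> //; lia.
Qed.

(** * Sums over the solutions of a square plus a product *)

(** Factorizations [n = d * e] are handled as pairs of positive integers in
    [int], since the transformations below involve subtractions. *)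
Definition divpairs : set (int * int) := [set p | 0 < p.1 /\ 0 < p.2].
Definition divprod (p : int * int) : int := p.1 * p.2.

Lemma finite_fibers_sqr : finite_fibers [set: int] (fun x => x ^+ 2).
Proof.
split=> [x _|n] /=; first exact: sqr_ge0.
apply: sub_finite_set (finite_int_box n%:Z) => x /= [_ xn]; nia.
Qed.

Lemma finite_fibers_divpairs : finite_fibers divpairs divprod.
Proof.
split=> [[d e]|n]; rewrite /divpairs /divprod /=; first by move=> [? ?]; nia.
apply: sub_finite_set (finite_setX (finite_int_box n%:Z) (finite_int_box n%:Z)).
by move=> [d e] /= [[d0 e0] den]; split => /=; nia.
Qed.

(** The coefficients of [varphi (- q)], as [x] and [x ^+ 2] have the same
    parity. *)
Definition signed_square_count := fiber_sum [set: int] (fun x => x ^+ 2) altsign.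

(** Up to the factor [- 8], the coefficients of [varphi (- q) ^+ 4]. *)
Definition tau := fiber_sum divpairs divprod (fun p => altsign (p.1 + p.2) * p.1).

Lemma fiber_sum_divpairs0 w : fiber_sum divpairs divprod w 0 = 0.
Proof.
rewrite /fiber_sum fsbig1// => -[d e] [] /=.
by rewrite /divpairs /divprod /= => -[? ?]; nia.
Qed.

Lemma tau0 : tau 0 = 0.
Proof. exact: fiber_sum_divpairs0. Qed.

Definition square_plus_product (n : nat) : set (int * (int * int)) :=
  ([set: int] `*` divpairs) `&` [set t | t.1 ^+ 2 + divprod t.2 = n%:Z].

Lemma finite_square_plus_product n : finite_set (square_plus_product n).
Proof. exact: (finite_fibersX finite_fibers_sqr finite_fibers_divpairs).2. Qed.

(** Here [t = (i, (d, e))] ranges over the solutions of [i^2 + d e = n]. With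
    [F x y z = (-1)^(x + y) x y z], which is odd in [x] and satisfies
    [F x (- y) (- z) = F x y z], the summands are
    [U t = F (e - 2 i) (d + i) (2 d + 2 i - e)] and
    [V t = F (d + e) i (d - e)]. *)
Section LiouvilleSquare.
Variable n : nat.
Local Notation S := (square_plus_product n).
Let finS := finite_square_plus_product n.

Let sgn (t : int * (int * int)) : int := altsign (t.1 + t.2.1 + t.2.2).
Let U t : int := sgn t * ((t.2.2 - 2 * t.1) * (t.2.1 + t.1) * (2 * t.2.1 + 2 * t.1 - t.2.2)).
Let V t : int := sgn t * ((t.2.1 + t.2.2) * t.1 * (t.2.1 - t.2.2)).
Let neg (t : int * (int * int)) : int * (int * int) := (- t.1, t.2).
Let swap (t : int * (int * int)) : int * (int * int) := (t.1, (t.2.2, t.2.1)).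

Let S_neg t : S t -> S (neg t).
Proof. by case: t => i [d e] [[/= _ ?] /= tn]; split=> //=; rewrite sqrrN. Qed.

Let S_swap t : S t -> S (swap t).
Proof.
case: t => i [d e] [[/= _ [? ?]] /= tn]; split=> //=.
by rewrite /divprod/= mulrC.
Qed.

Let sum_neg (F : _ -> int) : \sum_(t \in S) F (neg t) = \sum_(t \in S) F t.
Proof.
have negK t : neg (neg t) = t by case: t => ? ?; rewrite /neg/= opprK.
by apply: (fsbig_bij (f := neg) (g := neg)) => t tS; split; rewrite ?negK//;
  exact: S_neg.
Qed.

Let sum_swap (F : _ -> int) : \sum_(t \in S) F (swap t) = \sum_(t \in S) F t.
Proof.
by apply: (fsbig_bij (f := swap) (g := swap)) => -[? [? ?]] tS;
  split => //; exact: S_swap.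
Qed.

Let sgn_neg t : sgn (neg t) = sgn t.
Proof. by rewrite /sgn /= !altsignD altsignN. Qed.

Let sgn_swap t : sgn (swap t) = sgn t.
Proof. by rewrite /sgn /= !altsignD mulrAC. Qed.

(** Allows terms odd in [i] to be dropped from a summand and [d] to be exchanged
    with [e]. *)
Let symmetrize (F G : int * (int * int) -> int) :
  (forall t, F t + F (neg t) + (F (swap t) + F (neg (swap t))) =
             2 * (G t + G (swap t))) ->
  \sum_(t \in S) F t = \sum_(t \in S) G t.
Proof.
move=> FG.
have : \sum_(t \in S) (F t + F (neg t) + (F (swap t) + F (neg (swap t)))) =
       \sum_(t \in S) 2 * (G t + G (swap t)) by apply: eq_fsbigr => t _; exact: FG.
rewrite -mulr_fsumr (fsbigD (fun t => F t + F (neg t))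
  (fun t => F (swap t) + F (neg (swap t))))//.
rewrite (fsbigD F) // (fsbigD (fun t => F (swap t))) // (fsbigD G) //.
have -> : \sum_(t \in S) F (neg (swap t)) = \sum_(t \in S) F t.
  by rewrite (sum_swap (fun t => F (neg t))) sum_neg.
by rewrite (sum_neg F) (sum_swap F) (sum_swap G); lia.
Qed.

Let sumU : \sum_(t \in S) U t =
  \sum_(t \in S) sgn t * (t.2.1 * (t.2.1 * t.2.2 - 4 * t.1 ^+ 2)).
Proof.
apply: symmetrize => -[i [d e]]; rewrite /U sgn_neg sgn_swap sgn_neg sgn_swap /=.
by ring.
Qed.

Let key (t : int * (int * int)) : int := 2 * t.1 + t.2.1 - t.2.2.
Let keyV (t : int * (int * int)) : int := t.2.1 - 2 * t.1 - t.2.2.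

(** The map [(i, d, e) -> (e - i, 2 i + d - e, e)] keeps [d + i] and
    [2 d + 2 i - e] and changes the sign of [e - 2 i]. *)
Let sumU_pos : \sum_(t \in S `&` [set t | 0 < key t]) U t = 0.
Proof.
pose f (t : int * (int * int)) : int * (int * int) :=
  (t.2.2 - t.1, (2 * t.1 + t.2.1 - t.2.2, t.2.2)).
apply: (fsbig_sign_reversing (f := f)) => -[i [d e]] [[[/= _ [/= d0 e0]] tn]].
rewrite /key /= => t0; split.
- by split; [split; [split|]|] => //=; rewrite -?tn /key /divprod /=; first [ring|lia].
- by rewrite /f /=; congr (_, (_, _)); ring.
- rewrite /U (_ : sgn (f _) = sgn (i, (d, e))) /sgn /f /=; first by ring.
  by congr altsign; ring.
Qed.

(** The map [(i, d, e) -> (i + d, d, e - 2 i - d)] carries the arguments of [F]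
    in [U] to those in [V]. *)
Let sumU_neg : \sum_(t \in S `&` [set t | key t < 0]) U t =
  \sum_(t \in S `&` [set t | keyV t < 0]) V t.
Proof.
pose f (t : int * (int * int)) : int * (int * int) :=
  (t.1 + t.2.1, (t.2.1, t.2.2 - 2 * t.1 - t.2.1)).
pose g (t : int * (int * int)) : int * (int * int) :=
  (t.1 - t.2.1, (t.2.1, 2 * t.1 + t.2.2 - t.2.1)).
apply: (fsbig_bij (f := f) (g := g)) => -[i [d e]] [[[/= _ [/= d0 e0]] tn]];
  rewrite /key /keyV /f /g /= => t0; split.
- split; [split; [split|]|] => //=; rewrite -?tn /divpairs /key /keyV /divprod /=; first [ring|lia].
- by rewrite /key /keyV /=; congr (_, (_, _)); ring.
- rewrite /U /V /= /key/=; congr (_ * _); last by ring.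
  by apply: (@altsign_mod2 _ _ (- i)); rewrite /=; ring.
- split; [split; [split|]|] => //=; rewrite -?tn /divpairs /key /keyV /divprod /=; first [ring|lia].
- by rewrite /key /keyV /=; congr (_, (_, _)); ring.
Qed.

(** [V] is odd under [i -> - i], so its total vanishes; it is invariant under
    [(i, d, e) -> (- i, e, d)], which changes the sign of [keyV]. *)
Let sumV : 2 * \sum_(t \in S `&` [set t | keyV t < 0]) V t =
  - \sum_(t \in S `&` [set t | keyV t = 0]) V t.
Proof.
have V0 : \sum_(t \in S) V t = 0.
  apply: (fsbig_sign_reversing (f := neg)) => t tS; split; first exact: S_neg.
    by case: t {tS} => i p; rewrite /neg /= opprK.
  by rewrite /V sgn_neg /=; ring.
have Vneg : \sum_(t \in S `&` [set t | keyV t < 0]) V t =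
            \sum_(t \in S `&` [set t | 0 < keyV t]) V t.
  pose f t := swap (neg t).
  have fK t : f (f t) = t by case: t => ? [? ?]; rewrite /f /swap/= /neg/= opprK.
  apply: (fsbig_bij (f := f) (g := f)) => t [tS]; rewrite /keyV /= => t0; split;
    rewrite ?fK//.
  - by split; [exact/S_swap/S_neg|rewrite /keyV/=; lia].
  - by rewrite /V sgn_swap sgn_neg /=; ring.
  - by split; [exact/S_swap/S_neg|rewrite /keyV/=; lia].
rewrite (@fsbig_trichotomy _ S keyV V finS) -Vneg in V0.
move: V0; do 2 move: (\sum_(t \in _) V t) => ?; lia.
Qed.

Let B := S `&` [set t | key t = 0].

(** The left side is the sum of [U]. By the three previous facts only the
    solutions with [key t = 0] remain, together with those with [keyV t = 0],
    which the exchange of [d] and [e] identifies with the former. *)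
Lemma liouville_square :
  \sum_(t \in S) altsign (t.1 + t.2.1 + t.2.2) *
                 (t.2.1 * (t.2.1 * t.2.2 - 4 * t.1 ^+ 2)) =
  \sum_(t \in B) altsign t.1 * (t.1 + t.2.1) * (t.2.1 ^+ 2 - 2 * t.1 ^+ 2).
Proof.
rewrite -sumU (@fsbig_trichotomy _ S key U finS) sumU_pos sumU_neg.
have sgnB t : B t -> sgn t = altsign t.1.
  case: t => i [d e] [_]; rewrite /key /sgn /= => te.
  by apply: (@altsign_mod2 _ _ (i + d)); lia.
have -> : \sum_(t \in B) U t = \sum_(t \in B) altsign t.1 * ((t.1 + t.2.1) * t.2.1 ^+ 2).
  apply: eq_fsbigr => -[i [d e]] /set_mem tB; rewrite /U sgnB//; move: tB => [_].
  by rewrite /key /= => te; rewrite (_ : e = 2 * i + d); [ring|lia].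
have VB : \sum_(t \in S `&` [set t | keyV t = 0]) V t =
          4 * \sum_(t \in B) altsign t.1 * ((t.1 + t.2.1) * t.1 ^+ 2).
  rewrite mulr_fsumr.
  have tE t : (S `&` [set t | keyV t = 0]) t -> B (swap t).
    by move=> [tS]; rewrite /keyV /= => t0; split; [exact: S_swap|rewrite /key/=; lia].
  apply: (fsbig_bij (f := swap) (g := swap)) => -[i [d e]] tS; split=> //.
  - exact: tE.
  - rewrite /V -sgn_swap sgnB; last exact: tE.
    move: tS => [_]; rewrite /keyV /= => te; rewrite (_ : d = 2 * i + e); last by lia.
    by ring.
  - split; first by apply: S_swap; case: tS.
    by case: tS => _; rewrite /key /keyV /=; lia.
have finB : finite_set B by exact: finite_setIl.
have -> : \sum_(t \in B) altsign t.1 * (t.1 + t.2.1) * (t.2.1 ^+ 2 - 2 * t.1 ^+ 2) =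
  \sum_(t \in B) altsign t.1 * ((t.1 + t.2.1) * t.2.1 ^+ 2) -
  2 * \sum_(t \in B) altsign t.1 * ((t.1 + t.2.1) * t.1 ^+ 2).
  rewrite mulr_fsumr -fsbigN -fsbigD//; apply: eq_fsbigr => t _; by ring.
move: sumV; rewrite VB; do 3 move: (\sum_(t \in _) _) => ?; lia.
Qed.

End LiouvilleSquare.

(** * The four-square theorem *)

(** The summand is a difference of consecutive values of
    [(-1)^i (i^2 + (2 s - 1) i - s^2 - s) / 2]. *)
Lemma alternating_quadratic_sum (s c : int) (m : nat) :
  2 * \sum_(j < m) altsign (c + j%:Z) *
        ((s - (c + j%:Z)) ^+ 2 - 2 * (c + j%:Z) ^+ 2) =
  altsign (c + m%:Z) *
    ((c + m%:Z) ^+ 2 + (2 * s - 1) * (c + m%:Z) - s ^+ 2 - s) -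
  altsign c * (c ^+ 2 + (2 * s - 1) * c - s ^+ 2 - s).
Proof.
elim: m => [|m IHm]; first by rewrite big_ord0 addr0 mulr0 subrr.
rewrite big_ord_recr /= mulrDr IHm.
have -> : c + m.+1%:Z = c + m%:Z + 1 by lia.
rewrite (altsignD _ 1); have -> : altsign 1 = -1 by [].
by ring.
Qed.

Lemma signed_square_count0 : signed_square_count 0 = 1.
Proof.
rewrite /signed_square_count /fiber_sum (_ : _ `&` _ = [set 0]) ?fsbig_set1//.
apply/seteqP; split=> x /=; last by move=> ->.
by move=> [_ /eqP]; rewrite expf_eq0 => /eqP.
Qed.

Lemma signed_square_count_sqr (s : nat) : (0 < s)%N ->
  signed_square_count (s ^ 2) = 2 * altsign s%:Z.
Proof.
move=> s0; rewrite /signed_square_count /fiber_sum (_ : _ `&` _ = [set` [:: s%:Z; - s%:Z]]).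
  rewrite -fsbig_seq; last by rewrite /= inE; lia.
  by rewrite big_cons big_seq1 altsignN mulr_natl mulr2n.
apply/seteqP; split=> x /=; rewrite !inE; last first.
  by move=> /orP[/eqP->|/eqP->]; split=> //=; nia.
move=> [_ xs]; have : x ^+ 2 == s%:Z ^+ 2 by apply/eqP; rewrite xs; nia.
by rewrite eqf_sqr.
Qed.

Lemma signed_square_count_nonsqr n : (forall s, (0 < s)%N -> n <> (s ^ 2)%N) ->
  (0 < n)%N -> signed_square_count n = 0.
Proof.
move=> nsq n0; rewrite /signed_square_count /fiber_sum fsbig1// => x [_ /= xn].
case: (nsq `|x|%N); nia.
Qed.

(** The solutions with [e = 2 i + d] satisfy [n = (i + d)^2]. If [n = s^2] with
    [s] positive, they are [(i, s - i, s + i)] for [- s < i < s], and the sum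
    over [i] telescopes. *)
Lemma boundary_sum n : (0 < n)%N ->
  n%:Z * signed_square_count n =
  - (2 * \sum_(t \in square_plus_product n `&` [set t | 2 * t.1 + t.2.1 - t.2.2 = 0])
           altsign t.1 * (t.1 + t.2.1) * (t.2.1 ^+ 2 - 2 * t.1 ^+ 2)).
Proof.
move=> n0; have [[s [s0 ->]]|nsq] := pselect (exists s, (0 < s)%N /\ n = (s ^ 2)%N).
  rewrite signed_square_count_sqr//.
  pose f (t : int * (int * int)) : nat := absz (t.1 + s%:Z - 1)%R.
  pose g (j : nat) : int * (int * int) :=
    (1 - s%:Z + j%:Z, (s%:Z - (1 - s%:Z + j%:Z), s%:Z + (1 - s%:Z + j%:Z))).
  have BE i d e : (square_plus_product (s ^ 2) `&`
      [set t | 2 * t.1 + t.2.1 - t.2.2 = 0]) (i, (d, e)) ->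
      [/\ - s%:Z < i, i < s%:Z, d = s%:Z - i & e = s%:Z + i].
    rewrite /square_plus_product /divpairs /divprod /=.
    move=> [[[_ [d0 e0]] tn] t0].
    have eE : e = 2 * i + d by lia.
    have : (i + d) ^+ 2 = s%:Z ^+ 2 by rewrite eE in tn; nia.
    move=> /eqP; rewrite eqf_sqr => /orP[] /eqP h; split; lia.
  rewrite (@fsbig_bij _ _ _ `I_(2 * s - 1) f g _
    (fun j => altsign (1 - s%:Z + j%:Z) * s%:Z *
      ((s%:Z - (1 - s%:Z + j%:Z)) ^+ 2 - 2 * (1 - s%:Z + j%:Z) ^+ 2))).
  - rewrite -fsbig_ord.
    under eq_bigr => j _ do rewrite (mulrC (altsign _)) -mulrA.
    rewrite -mulr_sumr [X in - X]mulrCA alternating_quadratic_sum.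
    rewrite (_ : 1 - s%:Z + (2 * s - 1)%N%:Z = s%:Z); last by lia.
    rewrite (@altsign_mod2 (1 - s%:Z) (s%:Z + 1) (- s%:Z)); last by ring.
    rewrite altsignD; have -> : altsign 1 = -1 by [].
    by rewrite -mulnn PoszM; ring.
  - move=> [i [d e]] /BE[i1 i2 -> ->].
    have fi : 1 - s%:Z + (f (i, (s%:Z - i, s%:Z + i)))%:Z = i by rewrite /f /=; lia.
    split; first by rewrite /f /=; lia.
      by rewrite /g fi.
    by rewrite fi /=; ring.
  - move=> j /= js; split; last by rewrite /f /g /=; lia.
    rewrite /square_plus_product /divpairs /divprod /g /=.
    split; [split; [split=> //; split; lia|]|ring].
    by rewrite -mulnn PoszM; ring.
rewrite signed_square_count_nonsqr// ?fsbig1 ?mulr0 ?oppr0//.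
  move=> [i [d e]]; rewrite /square_plus_product /divpairs /divprod /=.
  move=> [[[_ [d0 e0]] tn] t0]; exfalso; apply: nsq; exists (absz (i + d)%R).
  have eE : e = 2 * i + d by lia.
  have : (i + d) ^+ 2 = n%:Z by rewrite -tn eE; ring.
  by nia.
by move=> s s0 ns; apply: nsq; exists s.
Qed.

Definition four_square_coef (n : nat) : int := (n == 0%N)%:Z - 8 * tau n.

(** For [n = i^2 + d e] one has [n - 5 i^2 = d e - 4 i^2], which is the weight
    in [liouville_square]. The constant term of [four_square_coef] accounts for
    the summand [j = n], which is balanced by [boundary_sum]. *)
Lemma four_square_recurrence n : (0 < n)%N ->
  \sum_(j < n.+1) (n%:Z - 5 * j%:Z) * signed_square_count j *
    four_square_coef (n - j) = 0.
Proof.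
move=> n0.
have sqw j : j%:Z * signed_square_count j =
    fiber_sum [set: int] (fun x => x ^+ 2) (fun x => x ^+ 2 * altsign x) j.
  by rewrite /signed_square_count /fiber_sum mulr_fsumr; apply: eq_fsbigr => x /set_mem[_ /= ->].
have convE w : conv (fiber_sum [set: int] (fun x => x ^+ 2) w) tau n =
    \sum_(t \in square_plus_product n) w t.1 * (altsign (t.2.1 + t.2.2) * t.2.1).
  by rewrite (conv_fiber_sum _ _ finite_fibers_sqr finite_fibers_divpairs).
have key : n%:Z * conv signed_square_count tau n -
    5 * conv (fiber_sum [set: int] (fun x => x ^+ 2) (fun x => x ^+ 2 * altsign x)) tau n =
    \sum_(t \in square_plus_product n) altsign (t.1 + t.2.1 + t.2.2) *
                 (t.2.1 * (t.2.1 * t.2.2 - 4 * t.1 ^+ 2)).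
  rewrite !convE !mulr_fsumr -fsbigN -fsbigD; last exact: finite_square_plus_product.
  apply: eq_fsbigr => -[i [d e]] /set_mem[_ /=]; rewrite /divprod /= => <-.
  by rewrite !altsignD; ring.
have : \sum_(j < n.+1) (n%:Z - 5 * j%:Z) * signed_square_count j * tau (n - j) =
    \sum_(t \in square_plus_product n) altsign (t.1 + t.2.1 + t.2.2) *
                 (t.2.1 * (t.2.1 * t.2.2 - 4 * t.1 ^+ 2)).
  rewrite -key /conv !mulr_sumr -sumrB; apply: eq_bigr => j _.
  by rewrite -sqw; ring.
rewrite liouville_square => sumtau.
under eq_bigr do rewrite /four_square_coef mulrBr mulrCA.
rewrite sumrB -mulr_sumr sumtau big_ord_recr /= subnn eqxx mulr1 big1 ?add0r; last first.
  by move=> j _; rewrite (_ : (n - j == 0)%N = false) ?mulr0//; have := ltn_ord j; lia.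
by have := boundary_sum n0; move: (\sum_(t \in _) _) => b bE; nia.
Qed.

(** If [p = f ^+ k], then [f p' = k f' p]. Reading the coefficient of [q^n] in
    this equation after multiplication by [q] gives a recurrence in which
    [p`_n] has coefficient [n], so that it determines [p] from [p`_0]. *)
Lemma power_from_recurrence (f c : nat -> int) (k : nat) :
  f 0%N = 1 -> c 0%N = 1 ->
  (forall n, (0 < n)%N ->
    \sum_(j < n.+1) (n%:Z - k.+1%:Z * j%:Z) * f j * c (n - j)%N = 0) ->
  forall N n, (n < N)%N -> ((\poly_(i < N) f i) ^+ k)`_n = c n.
Proof.
move=> f0 c0 rec N n nN; set F := \poly_(i < N) f i.
have FE i : (i < N)%N -> F`_i = f i by move=> iN; rewrite coef_poly iN.
have coefXD (p : {poly int}) i : ('X * p^`())`_i = i%:Z * p`_i.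
  rewrite coefXM coef_deriv; case: i => [|i]; first by rewrite mul0r.
  by rewrite /= -mulr_natl natz.
have log_deriv : F * ('X * (F ^+ k)^`()) = (k%:R *: ('X * F^`())) * F ^+ k.
  rewrite deriv_exp; case: k {rec} => [|k].
    by rewrite mulr0n mulr0 mulr0 scale0r mul0r.
  by rewrite -mul_polyC polyC_natr exprS /= -mulr_natl; ring.
have rec_pow m : (m < N)%N ->
    \sum_(j < m.+1) (m%:Z - k.+1%:Z * j%:Z) * f j * (F ^+ k)`_(m - j) = 0.
  move=> mN; have /eqP := congr1 (fun p : {poly int} => p`_m) log_deriv.
  rewrite -subr_eq0 !coefM -sumrB => /eqP h; rewrite -[RHS]h; apply: eq_bigr => j _.
  have jm : (j <= m)%N by rewrite -ltnS.
  rewrite coefZ !coefXD FE ?(leq_ltn_trans jm)// -subzn// natz.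
  by rewrite (_ : k.+1%:Z = k%:Z + 1); [ring|lia].
elim/ltn_ind: n nN => n IHn nN; have [->|n0] := posnP n.
  rewrite c0 -horner_coef0 horner_exp horner_coef0 FE ?f0 ?expr1n//.
  exact: leq_ltn_trans nN.
move: (rec_pow n nN) (rec n n0).
rewrite !big_ord_recl /= f0 mulr0 subr0 !subn0 !mulr1.
have -> : \sum_(i < n) (n%:Z - k.+1%:Z * (bump 0 i)%:Z) * f (bump 0 i) *
                       (F ^+ k)`_(n - bump 0 i) =
          \sum_(i < n) (n%:Z - k.+1%:Z * (bump 0 i)%:Z) * f (bump 0 i) *
                       c (n - bump 0 i)%N.
  by apply: eq_bigr => j _; rewrite IHn // /bump /=; have := ltn_ord j; lia.
by move=> pE; rewrite -[RHS]pE => /addIr /mulfI -> //; lia.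
Qed.

Lemma four_square_formula N n : (n < N)%N ->
  ((\poly_(i < N) signed_square_count i) ^+ 4)`_n = four_square_coef n.
Proof.
apply: power_from_recurrence; last exact: four_square_recurrence.
  exact: signed_square_count0.
by rewrite /four_square_coef tau0.
Qed.

(** * Representations as sums of two squares *)

(** The coefficients of [varphi q]. *)
Definition square_count := fiber_sum [set: int] (fun x => x ^+ 2) (fun=> 1).

(** If [x^2 + y^2 = 2 n], then [x] and [y] have the same parity and
    [n = ((x + y) / 2)^2 + ((x - y) / 2)^2]. *)
Lemma two_squares_double n : conv square_count square_count (2 * n) =
  conv square_count square_count n.
Proof.
rewrite !(conv_fiber_sum _ _ finite_fibers_sqr finite_fibers_sqr); symmetry.
apply: (fsbig_bij (f := fun p => (p.1 + p.2, p.1 - p.2))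
  (g := fun p => (((p.1 + p.2) %/ 2)%Z, ((p.1 - p.2) %/ 2)%Z))) => -[x y] [_ /= xy].
  split=> //=; last by congr (_, _); lia.
  by split=> //=; rewrite PoszM -xy; ring.
have par : (x - y) %% 2 = 0 :> int by nia.
set u := ((x + y) %/ 2)%Z; set v := ((x - y) %/ 2)%Z.
have [xE yE] : x = u + v /\ y = u - v by rewrite /u /v; lia.
split; last by rewrite /= -xE -yE.
split=> //=; suff : 2 * (u ^+ 2 + v ^+ 2) = 2 * n%:Z by lia.
by rewrite -PoszM -xy xE yE; ring.
Qed.

(** * Relations between divisor sums *)
Definition divfiber n : set (int * int) := divpairs `&` [set p | divprod p = n%:Z].

Lemma divfiberP n d e : divfiber n (d, e) <-> [/\ 0 < d, 0 < e & d * e = n%:Z].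
Proof.
rewrite /divfiber /divpairs /divprod /=.
by split=> [[[? ?] ?]|[? ? ?]].
Qed.

Lemma finite_divfiber n : finite_set (divfiber n).
Proof. exact: finite_fibers_divpairs.2. Qed.

Lemma divfiber_swap n (F : int * int -> int) :
  \sum_(p \in divfiber n) F (p.2, p.1) = \sum_(p \in divfiber n) F p.
Proof.
by apply: (fsbig_bij (f := fun p => (p.2, p.1)) (g := fun p => (p.2, p.1))) =>
  -[d e] /divfiberP[d0 e0 de]; split=> //=; apply/divfiberP; split=> //;
  rewrite mulrC.
Qed.

Lemma sum_divisors n (F : int * int -> int) : (0 < n)%N ->
  \sum_(d <- divisors n) F (d%:Z, (n %/ d)%N%:Z) = \sum_(p \in divfiber n) F p.
Proof.
move=> n0; rewrite fsbig_seq ?divisors_uniq//.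
apply: (fsbig_bij (f := fun d : nat => (d%:Z, (n %/ d)%N%:Z)) (g := fun p => `|p.1|%N)).
  move=> d; rewrite /= -dvdn_divisors// => dn; split=> //; apply/divfiberP.
  have d0 : (0 < d)%N by exact: dvdn_gt0 dn.
  split; first by rewrite ltz_nat.
    by rewrite ltz_nat divn_gt0//; exact: dvdn_leq.
  by rewrite -PoszM; congr Posz; rewrite mulnC; exact: divnK.
move=> [d e] /divfiberP[d0 e0 de] /=; rewrite -dvdn_divisors//.
have nE : n = (`|d| * `|e|)%N by nia.
split; first by rewrite nE dvdn_mulr.
by rewrite nE mulKn; [congr (_, _); lia|lia].
Qed.

Lemma altsign_pred (n : nat) : (0 < n)%N -> (-1) ^+ n.-1 = - altsign n%:Z :> int.
Proof. by case: n => // n _; rewrite /altsign /= exprS mulN1r opprK. Qed.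

(** These extend [sigma_tilde s] and [sigma_hat 1] by 0 at [n = 0], a value that
    the series in the statement skip. *)
Definition tilde_coef s :=
  fiber_sum divpairs divprod (fun p => - altsign p.1 * p.1 ^+ s).

Definition hat_coef := fiber_sum divpairs divprod (fun p => - altsign p.2 * p.1).

Lemma sigma_tildeE s n : (0 < n)%N -> sigma_tilde s n = tilde_coef s n.
Proof.
move=> n0; rewrite /sigma_tilde /tilde_coef /fiber_sum -sum_divisors//.
apply: eq_big_seq => d; rewrite -dvdn_divisors// => dn.
by rewrite altsign_pred//; exact: dvdn_gt0 dn.
Qed.

Lemma sigma_hatE n : (0 < n)%N -> sigma_hat 1 n = hat_coef n.
Proof.
move=> n0; rewrite /sigma_hat /hat_coef /fiber_sum -sum_divisors//.
apply: eq_big_seq => d; rewrite -dvdn_divisors// => dn.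
have d0 : (0 < d)%N by exact: dvdn_gt0 dn.
by rewrite altsign_pred// divn_gt0//; exact: dvdn_leq.
Qed.

Definition odd_divisor_sum n : int :=
  \sum_(p \in divfiber n `&` [set p | odd `|p.1|]) p.1.

(** In a factorization [2 n = d * e] either [d] is even and [(d / 2, e)] is a
    factorization of [n], or [d] is odd and then [e] is even. *)
Lemma divfiber_double n (F : int * int -> int) :
  \sum_(p \in divfiber (2 * n)) F p =
  \sum_(p \in divfiber n) F (2 * p.1, p.2) +
  \sum_(p \in divfiber n `&` [set p | odd `|p.1|]) F (p.1, 2 * p.2).
Proof.
rewrite (@fsbigID _ _ _ _ [set p : int * int | odd `|p.1|] _ F (finite_divfiber _)).
rewrite [LHS]addrC; congr (_ + _); symmetry.
  apply: (fsbig_bij (f := fun p => (2 * p.1, p.2)) (g := fun p => ((p.1 %/ 2)%Z, p.2))).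
    move=> [d e] /divfiberP[d0 e0 de]; split=> //=.
      by split; [apply/divfiberP; split=> //; nia|rewrite /=; lia].
    by congr (_, _); lia.
  move=> [d e] [/divfiberP[d0 e0 de] /= od]; set f := (d %/ 2)%Z.
  have dE : d = 2 * f by rewrite /f; lia.
  split; last by rewrite -dE.
  by apply/divfiberP; split=> //; [lia|rewrite dE -mulrA in de; lia].
apply: (fsbig_bij (f := fun p => (p.1, 2 * p.2)) (g := fun p => (p.1, (p.2 %/ 2)%Z))).
  move=> [d e] [/divfiberP[d0 e0 de] /= od]; split=> //=.
    by split=> //; apply/divfiberP; split=> //; nia.
  by congr (_, _); lia.
move=> [d e] [/divfiberP[d0 e0 de] /= od].
set f := (e %/ 2)%Z; have ee : e = 2 * f.
  have : ~~ odd (`|d| * `|e|)%N by rewrite (_ : (_ * _ = 2 * n)%N) ?oddM//; nia.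
  by rewrite oddM od /= /f; lia.
split; last by rewrite /= -ee.
by split=> //; apply/divfiberP; split=> //; [lia|rewrite ee mulrCA in de; lia].
Qed.

Lemma odd_divisor_sum_double n : odd_divisor_sum (2 * n) = odd_divisor_sum n.
Proof.
rewrite /odd_divisor_sum fsbig_mkcondr.
rewrite (divfiber_double _ (fun p => if p \in [set p : int * int | odd `|p.1|] then p.1 else 0)).
rewrite fsbig1 ?add0r//; last by move=> p _; rewrite memNset//=; lia.
by apply: eq_fsbigr => p /set_mem[_ /= op]; rewrite mem_set.
Qed.

Lemma hat_coef_double_odd n : hat_coef (2 * n) = 2 * hat_coef n - odd_divisor_sum n.
Proof.
rewrite /hat_coef /fiber_sum /odd_divisor_sum -!/(divfiber _) divfiber_double /= mulr_fsumr -fsbigN.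
congr (_ + _); apply: eq_fsbigr => p _; first by ring.
by rewrite (@altsign_mod2 _ 0 p.2) ?mulN1r//; ring.
Qed.

Lemma odd_fiber n d e : odd n -> divfiber n (d, e) -> odd `|d| /\ odd `|e|.
Proof.
move=> on /divfiberP[d0 e0 de]; apply/andP; rewrite -oddM.
by rewrite (_ : (_ * _)%N = n)//; nia.
Qed.

Lemma altsign_odd x : odd `|x|%N -> altsign x = -1.
Proof. by move=> ox; rewrite /altsign -signr_odd ox. Qed.

(** For odd [n] both sides are the sum of all divisors, and doubling [n] changes
    neither side. *)
Lemma hat_coef_odd_divisors n : (0 < n)%N -> hat_coef n = odd_divisor_sum n.
Proof.
elim/ltn_ind: n => n IHn n0; have [on|en] := boolP (odd n).
  rewrite /odd_divisor_sum (_ : _ `&` _ = divfiber n).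
    apply: eq_fsbigr => -[d e] /set_mem /(odd_fiber on)[_ oe].
    by rewrite altsign_odd// opprK mul1r.
  by apply/seteqP; split=> [p []//|[d e] de]; split=> //; case: (odd_fiber on de).
have nE : n = (2 * n./2)%N by rewrite mul2n even_halfK.
rewrite nE odd_divisor_sum_double hat_coef_double_odd IHn; lia.
Qed.

Lemma hat_coef_double n : hat_coef (2 * n) = hat_coef n.
Proof.
have [->|n0] := posnP n; first by [].
by rewrite hat_coef_double_odd hat_coef_odd_divisors//; ring.
Qed.

Lemma tau_double n : tau (2 * n) = - 3 * hat_coef n.
Proof.
have [->|n0] := posnP n; first by rewrite muln0 tau0 /hat_coef fiber_sum_divpairs0 mulr0.
have -> : tau (2 * n) = - (2 * hat_coef n) - odd_divisor_sum n.
  rewrite /tau /hat_coef /fiber_sum /odd_divisor_sum -!/(divfiber _) divfiber_double /=.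
  rewrite mulr_fsumr -!fsbigN; congr (_ + _); apply: eq_fsbigr => p.
    by move=> _; rewrite (@altsign_mod2 _ p.2 p.1) ?[_ + p.2]addrC//; ring.
  move=> /set_mem[_ /= op].
  by rewrite (@altsign_mod2 _ p.1 p.2)// altsign_odd// mulN1r.
by rewrite hat_coef_odd_divisors//; ring.
Qed.

Lemma tau_odd n : odd n -> tau n = hat_coef n.
Proof.
move=> on; rewrite /tau /hat_coef /fiber_sum -!/(divfiber _).
apply: eq_fsbigr => -[d e] /set_mem /(odd_fiber on)[od oe] /=.
by rewrite altsignD !altsign_odd//; ring.
Qed.

Lemma tau_odd_tilde_coef n : odd n -> tau n = tilde_coef 1 n.
Proof.
move=> on; rewrite /tau /tilde_coef /fiber_sum -!/(divfiber _).
apply: eq_fsbigr => -[d e] /set_mem /(odd_fiber on)[od oe] /=.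
by rewrite altsignD !altsign_odd//; ring.
Qed.

(** * The convolution of tau with itself *)
Definition quads (n : nat) : set ((int * int) * (int * int)) :=
  (divpairs `*` divpairs) `&` [set t | divprod t.1 + divprod t.2 = n%:Z].

Lemma quadsP n a x b y : quads n ((a, x), (b, y)) <->
  [/\ 0 < a, 0 < x, 0 < b & 0 < y] /\ a * x + b * y = n%:Z.
Proof.
rewrite /quads /divpairs /divprod /=.
by split=> [[[[? ?] [? ?]] ?]|[[? ? ? ?] ?]].
Qed.

Lemma finite_quads n : finite_set (quads n).
Proof. exact: (finite_fibersX finite_fibers_divpairs finite_fibers_divpairs).2. Qed.

Lemma alternating_sum m : 2 * \sum_(j < m) altsign j.+1%:Z = altsign m%:Z - 1.
Proof.
elim: m => [|m IHm]; first by rewrite big_ord0.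
rewrite big_ord_recr /= mulrDr IHm (_ : m.+1%:Z = m%:Z + 1); last by lia.
by rewrite altsignD; have -> : altsign 1 = -1 by []; ring.
Qed.

Lemma alternating_sqr_sum m :
  2 * \sum_(j < m) altsign j.+1%:Z * j.+1%:Z ^+ 2 = altsign m%:Z * m%:Z * (m%:Z + 1).
Proof.
elim: m => [|m IHm]; first by rewrite big_ord0.
rewrite big_ord_recr /= mulrDr IHm (_ : m.+1%:Z = m%:Z + 1); last by lia.
by rewrite altsignD; have -> : altsign 1 = -1 by []; ring.
Qed.

Lemma sum_below_divisor n (F : int * int -> nat -> int) :
  \sum_(t \in [set t : (int * int) * nat | divfiber n t.1 /\ t.2.+1%:Z < t.1.1]) F t.1 t.2 =
  \sum_(p \in divfiber n) \sum_(j < `|p.1|.-1) F p j.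
Proof.
rewrite (_ : [set t | _] =
  (divfiber n `*` `I_n) `&` [set t : (int * int) * nat | t.2.+1%:Z < t.1.1]); last first.
  apply/seteqP; split=> [[[k l] j]|[[k l] j] [[]]//].
  move=> [/= kl jk]; split=> //; split=> //=.
  by case/divfiberP: kl => ? ?; nia.
rewrite fsbig_mkcondr.
rewrite -(@pair_fsbig _ _ _ _ _ _ _ (fun p j => if (p, j) \in [set t : (int * int) * nat | t.2.+1%:Z < t.1.1] then F p j else 0));
  [|exact: finite_divfiber|exact: finite_II].
apply: eq_fsbigr => -[k l] /set_mem /divfiberP[k0 l0 kl].
rewrite fsbig_ord (_ : `I_(`|(k, l).1|.-1) = `I_n `&` [set j | j.+1%:Z < k]); last first.
  by apply/seteqP; split=> j /=; [move=> ?; split|]; nia.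
rewrite fsbig_mkcondr; apply: eq_fsbigr => j _.
by congr (if _ then _ else _).
Qed.

(** Here [t = ((a, x), (b, y))] ranges over the solutions of [a x + b y = n]. As
    [4 a b = (a + b)^2 - (a - b)^2], four times the convolution is the sum of
    [Fp - Fm]. The rewriting [a x + b y = a (x + y) + (b - a) y] maps the solutions with
    [a < b] bijectively onto those with [y < x]. *)
Section TauConvolution.
Variable n : nat.
Let T := quads n.
Let finT : finite_set T := finite_quads n.

Let a (t : (int * int) * (int * int)) : int := t.1.1.
Let x (t : (int * int) * (int * int)) : int := t.1.2.
Let b (t : (int * int) * (int * int)) : int := t.2.1.
Let y (t : (int * int) * (int * int)) : int := t.2.2.

Let Fm t : int := altsign (a t + x t + b t + y t) * (a t - b t) ^+ 2.
Let Fp t : int := altsign (a t + x t + b t + y t) * (a t + b t) ^+ 2.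
Let G t : int := altsign (b t + x t) * b t ^+ 2.
Let G' t : int := altsign (a t + y t) * a t ^+ 2.

Let swap (t : (int * int) * (int * int)) := (t.2, t.1).
Let up t : (int * int) * (int * int) := ((a t, x t + y t), (b t - a t, y t)).
Let down t : (int * int) * (int * int) := ((a t, x t - y t), (a t + b t, y t)).

Let dA t : int := b t - a t.
Let dX t : int := x t - y t.

Let swap_T t : T t -> T (swap t).
Proof.
case: t => [[? ?] [? ?]] /quadsP[[? ? ? ?] h]; apply/quadsP; split=> //.
by rewrite addrC.
Qed.

Let sum_swap (F F' : _ -> int) (P P' : set _) :
  (forall t, P t -> P' (swap t)) -> (forall t, P' t -> P (swap t)) ->
  (forall t, F' (swap t) = F t) ->
  \sum_(t \in T `&` P) F t = \sum_(t \in T `&` P') F' t.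
Proof.
move=> PP' P'P FF'; have swapK t : swap (swap t) = t by case: t.
apply: (fsbig_bij (f := swap) (g := swap)) => t [Tt Pt]; rewrite swapK; split=> //.
- by split; [exact: swap_T|exact: PP'].
- by split; [exact: swap_T|exact: P'P].
Qed.

(** [down] is the inverse of [up]. *)
Let sum_up (F F' : _ -> int) : (forall t, F' (up t) = F t) ->
  \sum_(t \in T `&` [set t | 0 < dA t]) F t = \sum_(t \in T `&` [set t | 0 < dX t]) F' t.
Proof.
move=> FF'; apply: (fsbig_bij (f := up) (g := down)) => -[[a0 x0] [b0 y0]]
  [/quadsP[[? ? ? ?] h]]; rewrite /dA /dX /a /b /x /y /= => d0; split.
- split; last by rewrite /dX /x /y /=; lia.
  by apply/quadsP; rewrite /a /b /x /y /=; split; [split; lia|rewrite -h; ring].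
- by rewrite /down /up /a /b /x /y /=; congr (_, _, (_, _)); ring.
- exact: FF'.
- split; last by rewrite /dA /a /b /=; lia.
  by apply/quadsP; rewrite /a /b /x /y /=; split; [split; lia|rewrite -h; ring].
- by rewrite /down /up /a /b /x /y /=; congr (_, _, (_, _)); ring.
Qed.

Let GA := \sum_(t \in T `&` [set t | dA t = 0]) G t.
Let GX := \sum_(t \in T `&` [set t | dX t = 0]) G t.

Let sum_Fm : \sum_(t \in T) Fm t = 2 * \sum_(t \in T `&` [set t | 0 < dX t]) G t.
Proof.
rewrite (fsbig_trichotomy dA Fm finT).
rewrite (@sum_swap Fm Fm [set t | dA t < 0] [set t | 0 < dA t]); first last.
- by move=> t; rewrite /Fm /swap /a /b /x /y /= (_ : t.2.1 + _ + _ + _ = t.1.1 + t.1.2 + t.2.1 + t.2.2); ring.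
- by move=> t; rewrite /dA /swap /a /b /=; lia.
- by move=> t; rewrite /dA /swap /a /b /=; lia.
rewrite (@fsbig1 _ _ _ _ (T `&` [set t | dA t = 0])); last first.
  move=> t [_]; rewrite /dA /Fm /= => ab; rewrite (_ : a t - b t = 0); last by lia.
  by rewrite mulr0.
rewrite (@sum_up Fm G); first by rewrite addr0 mulr_natl mulr2n.
move=> t; rewrite /G /Fm /up /= /a /b /x /y /=; congr (_ * _); last by ring.
apply: (@altsign_mod2 _ _ (- t.1.1)); ring.
Qed.

Let sum_Fp : \sum_(t \in T) Fp t = 2 * \sum_(t \in T `&` [set t | 0 < dA t]) G t +
  \sum_(t \in T `&` [set t | dX t = 0]) Fp t.
Proof.
rewrite (fsbig_trichotomy dX Fp finT).
rewrite (@sum_swap Fp Fp [set t | dX t < 0] [set t | 0 < dX t]); first last.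
- by move=> t; rewrite /Fp /swap /a /b /x /y /= (_ : t.2.1 + _ + _ + _ = t.1.1 + t.1.2 + t.2.1 + t.2.2); ring.
- by move=> t; rewrite /dX /swap /x /y /=; lia.
- by move=> t; rewrite /dX /swap /x /y /=; lia.
rewrite -(@sum_up G Fp); first by rewrite addrAC mulr_natl mulr2n.
move=> t; rewrite /G /Fp /up /= /a /b /x /y /=; congr (_ * _); last by ring.
apply: (@altsign_mod2 _ _ (t.2.2)); ring.
Qed.

(** The part [x < y] of the sum of [G] equals its part [b < a]: exchange the two
    products, apply [down], and exchange again. *)
Let sum_G_diff : \sum_(t \in T `&` [set t | 0 < dA t]) G t -
  \sum_(t \in T `&` [set t | 0 < dX t]) G t = GX - GA.
Proof.
have e1 := fsbig_trichotomy dA G finT; have e2 := fsbig_trichotomy dX G finT.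
have e3 : \sum_(t \in T `&` [set t | dX t < 0]) G t = \sum_(t \in T `&` [set t | dA t < 0]) G t.
  rewrite (@sum_swap G G' [set t | dX t < 0] [set t | 0 < dX t]); first last.
  - by [].
  - by move=> t; rewrite /dX /swap /x /y /=; lia.
  - by move=> t; rewrite /dX /swap /x /y /=; lia.
  rewrite -(@sum_up G' G'); last first.
    move=> t; rewrite /G' /up /= /a /b /x /y /=; by [].
  apply: sum_swap => t; rewrite /dA /swap /a /b //=; lia.
rewrite -/GA in e1; rewrite -/GX in e2; rewrite e1 e3 in e2.
move: e2; do 3 move: (\sum_(t \in _) _) => ?; lia.
Qed.

(** Both [Fp] and [Fm] reduce to [G] on the open parts, and these cancel up to
    diagonal terms. *)
Lemma four_conv_tau : 4 * conv tau tau n = 2 * GX - 2 * GA +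
  \sum_(t \in T `&` [set t | dX t = 0]) Fp t.
Proof.
have -> : 4 * conv tau tau n = \sum_(t \in T) Fp t - \sum_(t \in T) Fm t.
  rewrite (conv_fiber_sum _ _ finite_fibers_divpairs finite_fibers_divpairs) /fiber_sum -/T.
  rewrite mulr_fsumr -fsbigN -fsbigD//; apply: eq_fsbigr => t _.
  by rewrite /Fp /Fm /a /b /x /y !altsignD; ring.
rewrite sum_Fp sum_Fm; move: sum_G_diff.
do 3 move: (\sum_(t \in _) _) => ?; lia.
Qed.

Let E := [set t : (int * int) * nat | divfiber n t.1 /\ t.2.+1%:Z < t.1.1].

(** The solutions with [x = y] are indexed by the factorizations
    [n = (a + b) * x] together with [b < a + b]; the index [j] stands for
    [b - 1]. Those with [a = b] are treated symmetrically. *)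
Let sum_equal_x (F : _ -> int) : \sum_(t \in T `&` [set t | dX t = 0]) F t =
  \sum_(u \in E) F ((u.1.1 - u.2.+1%:Z, u.1.2), (u.2.+1%:Z, u.1.2)).
Proof.
symmetry; apply: (fsbig_bij
  (f := fun u : (int * int) * nat => ((u.1.1 - u.2.+1%:Z, u.1.2), (u.2.+1%:Z, u.1.2)))
  (g := fun t => ((a t + b t, x t), `|b t|%N.-1))).
  move=> [[k l] j] [/= /divfiberP[k0 l0 kl] jk]; split=> //.
    split; last by rewrite /dX /x /y /= subrr.
    by apply/quadsP; split; [split; lia|rewrite -kl; ring].
  by rewrite /a /b /x /=; congr (_, _, _); lia.
move=> [[a0 x0] [b0 y0]] [/quadsP[[? ? ? ?] h]]; rewrite /dX /x /y /= => xy.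
have {xy}yx : y0 = x0 by lia.
rewrite yx in h *; split; last by rewrite /a /b /=; congr (_, _, (_, _)); lia.
by split; [apply/divfiberP; split; rewrite /a /b /= -?h; [lia|lia|ring]|rewrite /a /b /=; lia].
Qed.

Let sum_equal_a (F : _ -> int) : \sum_(t \in T `&` [set t | dA t = 0]) F t =
  \sum_(u \in E) F ((u.1.2, u.2.+1%:Z), (u.1.2, u.1.1 - u.2.+1%:Z)).
Proof.
symmetry; apply: (fsbig_bij
  (f := fun u : (int * int) * nat => ((u.1.2, u.2.+1%:Z), (u.1.2, u.1.1 - u.2.+1%:Z)))
  (g := fun t => ((x t + y t, a t), `|x t|%N.-1))).
  move=> [[k l] j] [/= /divfiberP[k0 l0 kl] jk]; split=> //.
    split; last by rewrite /dA /a /b /= subrr.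
    by apply/quadsP; split; [split; lia|rewrite -kl; ring].
  by rewrite /a /y /x /=; congr (_, _, _); lia.
move=> [[a0 x0] [b0 y0]] [/quadsP[[? ? ? ?] h]]; rewrite /dA /a /b /= => ab.
have {ab}ba : b0 = a0 by lia.
rewrite ba in h *; split; last by rewrite /x /y /=; congr (_, _, (_, _)); lia.
by split; [apply/divfiberP; split; rewrite /x /y /= -?h; [lia|lia|ring]|rewrite /x /y /=; lia].
Qed.

(** The inner sums over [j] are elementary alternating sums, and the exchange of
    the two factors makes the remaining squares cancel. *)
Lemma conv_tau : 4 * conv tau tau n = tau n - tilde_coef 3 n.
Proof.
rewrite four_conv_tau /GX /GA !sum_equal_x sum_equal_a !mulr_fsumr.
rewrite (sum_below_divisor n (fun p j => 2 * G ((p.1 - j.+1%:Z, p.2), (j.+1%:Z, p.2)))).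
rewrite (sum_below_divisor n (fun p j => 2 * G ((p.2, j.+1%:Z), (p.2, p.1 - j.+1%:Z)))).
rewrite (sum_below_divisor n (fun p j => Fp ((p.1 - j.+1%:Z, p.2), (j.+1%:Z, p.2)))).
have predE k : 0 < k -> (`|k|.-1)%:Z = k - 1 :> int by lia.
have altP (k : int) : altsign (k - 1) = - altsign k.
  by rewrite altsignD; have -> : altsign (- 1) = -1 by []; ring.
have -> : \sum_(p \in divfiber n) \sum_(j < `|p.1|.-1)
    2 * G ((p.1 - j.+1%:Z, p.2), (j.+1%:Z, p.2)) =
  \sum_(p \in divfiber n) altsign (p.1 + p.2) * (p.1 - p.1 ^+ 2).
  apply: eq_fsbigr => -[k l] /set_mem /divfiberP[k0 l0 _].
  rewrite -mulr_sumr /G /b /x /=.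
  under eq_bigr do rewrite altsignD (mulrC _ (altsign l)) -mulrA.
  rewrite -mulr_sumr mulrCA alternating_sqr_sum predE// altP altsignD; ring.
have -> : \sum_(p \in divfiber n) \sum_(j < `|p.1|.-1)
    2 * G ((p.2, j.+1%:Z), (p.2, p.1 - j.+1%:Z)) =
  \sum_(p \in divfiber n) - (altsign p.1 * p.1 ^+ 2 + altsign (p.1 + p.2) * p.1 ^+ 2).
  rewrite -[RHS]divfiber_swap; apply: eq_fsbigr => -[k l] /set_mem /divfiberP[k0 l0 _] /=.
  rewrite -mulr_sumr /G /b /x /=.
  under eq_bigr do rewrite altsignD (mulrC (altsign l)) -mulrA.
  rewrite -mulr_suml mulrA alternating_sum predE// altP altsignD; ring.
have -> : \sum_(p \in divfiber n) \sum_(j < `|p.1|.-1)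
    Fp ((p.1 - j.+1%:Z, p.2), (j.+1%:Z, p.2)) =
  \sum_(p \in divfiber n) altsign p.1 * p.1 ^+ 2 * (p.1 - 1).
  apply: eq_fsbigr => -[k l] /set_mem /divfiberP[k0 l0 _] /=.
  under eq_bigr => j _.
    rewrite /Fp /a /b /x /y /= subrK (@altsign_mod2 _ k l); last by ring.
    over.
  by rewrite sumr_const card_ord -mulr_natr natz predE.
rewrite /tau /tilde_coef /fiber_sum -!/(divfiber n) -!fsbigN.
rewrite -!fsbigD; try exact: finite_divfiber.
by apply: eq_fsbigr => -[k l] _ /=; ring.
Qed.

End TauConvolution.

(** * Power series in the unit disk *)
Definition psum (K : numFieldType) (c : nat -> int) (q : K) (N : nat) : K :=
  \sum_(i < N) (c i)%:~R * q ^+ i.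

Section SeriesInDisk.
Local Open Scope complex_scope.
Variable R : realType.
Local Notation C := (R[i] : numFieldType).

Definition modulus (z : C) : R := complex.Re `|z|.

Lemma modulusE z : `|z| = (modulus z)%:C.
Proof. by rewrite /modulus RRe_real// normr_real. Qed.

Lemma modulus_ge0 z : 0 <= modulus z.
Proof. by rewrite -ler0c -modulusE normr_ge0. Qed.

Lemma modulusM z w : modulus (z * w) = modulus z * modulus w.
Proof. by apply: (@complexI R); rewrite rmorphM -!modulusE normrM. Qed.

Lemma modulusX z n : modulus (z ^+ n) = modulus z ^+ n.
Proof. by apply: (@complexI R); rewrite rmorphXn -!modulusE normrX. Qed.

Lemma modulus_int (k : int) : modulus k%:~R = `|k|%:~R.
Proof. by apply: (@complexI R); rewrite -modulusE rmorph_int intr_norm. Qed.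

Lemma modulus_sum (I : Type) (r : seq I) (F : I -> C) :
  modulus (\sum_(i <- r) F i) <= \sum_(i <- r) modulus (F i).
Proof.
rewrite -lecR -modulusE rmorph_sum; apply: le_trans (ler_norm_sum _ _ _) _.
by apply: ler_sum => i _; rewrite modulusE.
Qed.

Lemma modulus_lt1 z : `|z| < 1 -> modulus z < 1.
Proof. by rewrite modulusE -ltcR. Qed.

Lemma cvg_complex_dominated (u : nat -> C) (l : C) (d : nat -> R) :
  d @ \oo --> 0 -> (forall n, `|l - u n| <= (d n)%:C) -> u @ \oo --> l.
Proof.
move=> /cvgrPdist_lt d0 ud; apply/cvgrPdist_lt => e e0.
have eE : e = (complex.Re e)%:C by rewrite RRe_real// gtr0_real.
have re0 : 0 < complex.Re e by rewrite -ltcR -eE.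
apply: filterS (d0 _ re0) => n /=; rewrite sub0r normrN => dn.
by apply: le_lt_trans (ud n) _; rewrite eE ltcR; apply: le_lt_trans dn; exact: ler_norm.
Qed.

Lemma cvg_complex (u : nat -> C) (a b : R) :
  (fun n => complex.Re (u n)) @ \oo --> a -> (fun n => complex.Im (u n)) @ \oo --> b ->
  u @ \oo --> (a +i* b : C).
Proof.
move=> ua ub; apply: (@cvg_complex_dominated _ _
  (fun n => `|a - complex.Re (u n)| + `|b - complex.Im (u n)|)).
  rewrite -[X in _ --> X]addr0; apply: cvgD; apply/norm_cvg0P.
    by rewrite -(subrr a); apply: cvgB; [exact: cvg_cst|exact: ua].
  by rewrite -(subrr b); apply: cvgB; [exact: cvg_cst|exact: ub].
move=> n; case: (u n) => x y /=.
rewrite (_ : (a +i* b : C) - (x +i* y : C) = (a - x)%:C + 'i%C * (b - y)%:C); last first.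
  by apply/eqP; rewrite eq_complex /=; apply/andP; split; apply/eqP; ring.
apply: le_trans (ler_normD _ _) _; rewrite normrM.
by rewrite !normc_def /= !expr0n /= expr1n !(addr0, add0r) !sqrtr_sqr
  sqrtr1 mul1r -rmorphD.
Qed.

Lemma cvg_bounded_series (v : nat -> R) (B : R) :
  (forall N, \sum_(i < N) `|v i| <= B) ->
  cvgn (fun N => \sum_(i < N) v i).
Proof.
move=> vB; have -> : (fun N => \sum_(i < N) v i) = series v.
  by apply/funext => N; rewrite /series /= big_mkord.
apply: normed_cvg; apply: nondecreasing_is_cvgn.
  by apply: nondecreasing_series => n _ _; exact: normr_ge0.
by exists B => _ [N _ <-]; have := vB N; rewrite -(big_mkord xpredT (fun i => `|v i|)).
Qed.

(** Completeness of the complex numbers, in the form needed here: an absolutely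
    summable series converges because its real and imaginary parts do. *)
Lemma cvg_absolute_series (u : nat -> C) (B : R) :
  (forall N, \sum_(i < N) modulus (u i) <= B) ->
  cvgn (fun N => \sum_(i < N) u i).
Proof.
move=> uB.
have [ReB ImB] : (forall N, \sum_(i < N) `|complex.Re (u i)| <= B) /\
                 (forall N, \sum_(i < N) `|complex.Im (u i)| <= B).
  split=> N; apply: le_trans (uB N); apply: ler_sum => i _;
    rewrite -lecR -modulusE; first exact: normc_ge_Re.
  rewrite normc_def lecR -sqrtr_sqr.
  by apply: ler_wsqrtr; rewrite lerDr sqr_ge0.
have /cvg_ex[a ua] := @cvg_bounded_series (fun i => complex.Re (u i)) B ReB.
have /cvg_ex[b ub] := @cvg_bounded_series (fun i => complex.Im (u i)) B ImB.
apply/cvg_ex; exists (a +i* b : C); apply: cvg_complex.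
  rewrite (_ : (fun n => _) = (fun N => \sum_(i < N) complex.Re (u i)))//.
  by apply/funext => N; rewrite (@big_morph _ _ _ 0 +%R 0 +%R)// => -[? ?] [? ?].
rewrite (_ : (fun n => _) = (fun N => \sum_(i < N) complex.Im (u i)))//.
by apply/funext => N; rewrite (@big_morph _ _ _ 0 +%R 0 +%R)// => -[? ?] [? ?].
Qed.

(** Absolute convergence in the unit disk, phrased with bounded partial sums at
    real points so that it passes to dominated sequences and to convolutions
    without taking limits. *)
Variant tame (c : nat -> int) : Prop :=
  Tame of forall x : R, 0 <= x -> x < 1 ->
    exists B : R, forall N, psum (fun i => `|c i|) x N <= B.

Definition gf (c : nat -> int) (q : C) : C := limn (psum c q).

Lemma gf_cvg c q : tame c -> `|q| < 1 -> psum c q @ \oo --> gf c q.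
Proof.
move=> [tc] q1; have [B cB] := tc _ (modulus_ge0 q) (modulus_lt1 q1).
apply: (@cvg_absolute_series (fun i => (c i)%:~R * q ^+ i) B) => N.
apply: le_trans (cB N); apply: ler_sum => i _.
by rewrite modulusM modulus_int modulusX.
Qed.

Lemma cvg_gf c q l : psum c q @ \oo --> l -> gf c q = l.
Proof. by move=> cl; apply/cvg_lim. Qed.

Lemma tame_dominated (a b b' : nat -> int) (k m : nat) :
  tame b -> tame b' ->
  (forall n, `|a n| <= k%:Z * `|b n| + m%:Z * `|b' n|) -> tame a.
Proof.
move=> [tb] [tb'] ab; constructor=> x x0 x1; have [B bB] := tb _ x0 x1; have [B' bB'] := tb' _ x0 x1.
exists (k%:R * B + m%:R * B') => N.
apply: le_trans (lerD (ler_wpM2l (ler0n _ k) (bB N)) (ler_wpM2l (ler0n _ m) (bB' N))).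
rewrite /psum !mulr_sumr -big_split /=; apply: ler_sum => i _.
rewrite !mulrA -mulrDl; apply: ler_wpM2r; first exact: exprn_ge0.
by have := ab i; rewrite -(ler_int R) rmorphD !rmorphM /=.
Qed.

Lemma tame_one : tame (fun=> 1).
Proof.
constructor=> x x0 x1; exists (1 - x)^-1 => N; have x10 : 0 < 1 - x by rewrite subr_gt0.
rewrite -[leRHS]mul1r ler_pdivlMr//.
have -> : psum (fun=> `|1|) x N * (1 - x) = 1 - x ^+ N.
  rewrite -[RHS]opprB subrX1 -mulNr opprB mulrC; congr (_ * _).
  by apply: eq_bigr => i _; rewrite normr1 mul1r.
by rewrite gerBl exprn_ge0.
Qed.

(** A coefficient of degree below [N] in a product of polynomials depends only
    on the coefficients of the factors below [N]. *)
Lemma coef_mul_trunc (K : nzRingType) (a b : nat -> int) N n (p r : {poly K}) :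
  (n < N)%N -> (forall i, (i < N)%N -> p`_i = (a i)%:~R) ->
  (forall i, (i < N)%N -> r`_i = (b i)%:~R) ->
  (p * r)`_n = (conv a b n)%:~R.
Proof.
move=> nN pa rb; rewrite coefM /conv rmorph_sum; apply: eq_bigr => i _.
rewrite pa ?rb ?rmorphM//; apply: leq_ltn_trans nN; first by rewrite leq_subr.
by rewrite -ltnS.
Qed.

(** The product of the [N]-th partial sums is a polynomial that agrees with the
    [N]-th partial sum of the convolution in degrees below [N]. The other terms
    are dominated by those of the product of the absolute series at a point [y]
    with [`|q| < y < 1], times [(`|q| / y)^N], which tends to 0. *)
Section CauchyProduct.
Variables (a b : nat -> int).

Let trunc (K : numFieldType) (c : nat -> int) N : {poly K} := \poly_(i < N) (c i)%:~R.

Let truncE (K : numFieldType) c N i : (i < N)%N -> (trunc K c N)`_i = (c i)%:~R.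
Proof. by move=> iN; rewrite coef_poly iN. Qed.

Let horner_trunc (K : numFieldType) c N (q : K) : (trunc K c N).[q] = psum c q N.
Proof. exact: horner_poly. Qed.

Let prod_abs N : {poly R} := trunc R (fun i => `|a i|) N * trunc R (fun i => `|b i|) N.

Let trunc_ge0 (c : nat -> int) N i : 0 <= (trunc R (fun i => `|c i|) N)`_i.
Proof. by rewrite coef_poly; case: ifP => // _; rewrite ler0z normr_ge0. Qed.

Let prod_abs_ge0 N n : 0 <= (prod_abs N)`_n.
Proof. by rewrite coefM; apply: sumr_ge0 => i _; apply: mulr_ge0. Qed.

Let horner_split (K : numFieldType) N (p r : {poly K}) q :
  (size p <= N)%N -> (size r <= N)%N ->
  (p * r).[q] = \sum_(i < N) (p * r)`_i * q ^+ i +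
                \sum_(i < N) (p * r)`_(N + i) * q ^+ (N + i).
Proof.
move=> sp sr; rewrite (@horner_coef_wide _ (N + N)) ?big_split_ord//.
apply: leq_trans (size_polyMleq _ _) _; apply: leq_trans (leq_pred _) _.
exact: leq_add.
Qed.

Let modulus_prod N n :
  modulus ((trunc C a N * trunc C b N)`_n) <= (prod_abs N)`_n.
Proof.
rewrite !coefM; apply: le_trans (modulus_sum _ _) _; apply: ler_sum => i _.
rewrite modulusM; apply: ler_pM; rewrite ?modulus_ge0// !coef_poly;
  by case: ifP => _; rewrite ?modulus_int// /modulus normr0.
Qed.

Lemma tame_conv : tame a -> tame b -> tame (conv a b).
Proof.
move=> [ta] [tb]; constructor=> x x0 x1; have [A aA] := ta _ x0 x1; have [B bB] := tb _ x0 x1.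
exists (A * B) => N; apply: (@le_trans _ _ (prod_abs N).[x]); last first.
  rewrite hornerM !horner_trunc; apply: ler_pM => //.
    by apply: sumr_ge0 => i _; rewrite mulr_ge0 ?exprn_ge0// ler0z normr_ge0.
  by apply: sumr_ge0 => i _; rewrite mulr_ge0 ?exprn_ge0// ler0z normr_ge0.
rewrite (@horner_split _ N); try exact: size_poly.
rewrite -[leLHS]addr0; apply: lerD; last first.
  by apply: sumr_ge0 => i _; rewrite mulr_ge0 ?exprn_ge0//; exact: prod_abs_ge0.
apply: ler_sum => i _; apply: ler_wpM2r; first exact: exprn_ge0.
rewrite (coef_mul_trunc (ltn_ord i) (@truncE R _ N) (@truncE R _ N)) ler_int.
apply: le_trans (ler_norm_sum _ _ _) _.
by apply: ler_sum => j _; rewrite normrM.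
Qed.

Lemma gf_conv q : tame a -> tame b -> `|q| < 1 ->
  gf (conv a b) q = gf a q * gf b q.
Proof.
move=> ta tb q1; apply: cvg_gf.
pose x := modulus q.
have x0 : 0 <= x := modulus_ge0 q; have x1 : x < 1 := modulus_lt1 q1.
have [y [xy y1 y0]] : exists y : R, [/\ x < y, y < 1 & 0 < y].
  by exists ((1 + x) / 2); split; lra.
have [[ta'] [tb']] := (ta, tb).
have [A aA] := ta' _ (ltW y0) y1; have [B bB] := tb' _ (ltW y0) y1.
pose diff N := psum a q N * psum b q N - psum (conv a b) q N.
have -> : psum (conv a b) q = (fun N => psum a q N * psum b q N - diff N).
  by apply/funext => N; rewrite /diff opprB addrC subrK.
rewrite -[X in _ --> X]subr0; apply: cvgB.
  by apply: cvgM; exact: gf_cvg.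
apply: (@cvg_complex_dominated _ _ (geometric (A * B) (x / y))).
  apply: cvg_geometric; rewrite ger0_norm ?divr_ge0 ?(ltW y0)//.
  by rewrite ltr_pdivrMr// mul1r.
move=> N; rewrite sub0r normrN modulusE lecR /geometric /=.
have -> : diff N = \sum_(i < N) (trunc C a N * trunc C b N)`_(N + i) * q ^+ (N + i).
  rewrite /diff -!horner_trunc -hornerM (@horner_split _ N); try exact: size_poly.
  rewrite [X in X - _]addrC -addrA [X in _ + X](_ : _ = 0) ?addr0//.
  rewrite horner_trunc; apply/eqP; rewrite subr_eq0; apply/eqP.
  apply: eq_bigr => i _; congr (_ * _).
  exact: (coef_mul_trunc (ltn_ord i) (@truncE C _ N) (@truncE C _ N)).
apply: le_trans (modulus_sum _ _) _.
apply: (@le_trans _ _ ((x / y) ^+ N * (prod_abs N).[y])); last first.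
  rewrite mulrC; apply: ler_wpM2r; first by rewrite exprn_ge0// divr_ge0// ltW.
  rewrite hornerM !horner_trunc; apply: ler_pM => //.
    by apply: sumr_ge0 => i _; rewrite mulr_ge0 ?exprn_ge0 ?(ltW y0)// ler0z normr_ge0.
  by apply: sumr_ge0 => i _; rewrite mulr_ge0 ?exprn_ge0 ?(ltW y0)// ler0z normr_ge0.
rewrite (@horner_split _ N); try exact: size_poly.
rewrite mulrDr -[leLHS]add0r; apply: lerD.
  apply: mulr_ge0; first by rewrite exprn_ge0// divr_ge0// ltW.
  by apply: sumr_ge0 => i _; rewrite mulr_ge0 ?exprn_ge0 ?(ltW y0)//; exact: prod_abs_ge0.
rewrite mulr_sumr; apply: ler_sum => i _.
rewrite modulusM modulusX mulrCA; apply: ler_pM.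
- exact: modulus_ge0.
- exact: exprn_ge0.
- exact: modulus_prod.
rewrite -/x !exprD mulrA -exprMn divfK ?gt_eqF//; apply: ler_wpM2l; first exact: exprn_ge0.
by apply: lerXn2r; rewrite ?nnegrE ?(ltW y0) ?(ltW xy).
Qed.

End CauchyProduct.

Lemma gf_linear (a b b' : nat -> int) (k m q q1 q2 : C) :
  tame b -> tame b' -> `|q1| < 1 -> `|q2| < 1 ->
  (forall n, (a n)%:~R * q ^+ n =
     k * ((b n)%:~R * q1 ^+ n) + m * ((b' n)%:~R * q2 ^+ n)) ->
  gf a q = k * gf b q1 + m * gf b' q2.
Proof.
move=> tb tb' q11 q21 ab; apply: cvg_gf.
have -> : psum a q = (fun N => k * psum b q1 N + m * psum b' q2 N).
  by apply/funext => N; rewrite /psum !mulr_sumr -big_split; apply: eq_bigr.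
by apply: cvgD; apply: cvgMr; exact: gf_cvg.
Qed.

Lemma cvg_subseq (u : nat -> C) (l : C) (h : nat -> nat) :
  (forall n, (n <= h n)%N) -> u @ \oo --> l -> (u \o h) @ \oo --> l.
Proof.
move=> hn ul; apply: cvg_comp ul; apply/cvgnyPge => A.
by exists A => // n /= An; exact: leq_trans (hn n).
Qed.

(** The odd terms cancel in the sum of the values at [q] and [- q]. *)
Lemma gf_even (c c' : nat -> int) q : tame c -> tame c' -> `|q| < 1 ->
  (forall n, c (2 * n)%N = c' n) -> gf c q + gf c (- q) = 2 * gf c' (q ^+ 2).
Proof.
move=> tc tc' q1 cc'.
have q21 : `|q ^+ 2| < 1 by rewrite normrX exprn_ilt1.
have Nq1 : `|- q| < 1 by rewrite normrN.
have: (fun N => psum c q N + psum c (- q) N) @ \oo --> gf c q + gf c (- q).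
  by apply: cvgD; exact: gf_cvg.
have le2 n : (n <= 2 * n)%N by exact: leq_pmull.
move=> /(@cvg_subseq _ _ (fun n => 2 * n)%N le2) h1.
have h2 : (fun N => 2 * psum c' (q ^+ 2) N) @ \oo --> 2 * gf c' (q ^+ 2).
  by apply: cvgMr; exact: gf_cvg.
suff e : (fun N => 2 * psum c' (q ^+ 2) N) =
    (fun N => psum c q N + psum c (- q) N) \o (fun N => 2 * N)%N.
  by rewrite e in h2; exact: (cvg_unique _ h1 h2).
apply/funext => N /=; elim: N => [|N IHN].
  by rewrite /psum !big_ord0 addr0 mulr0.
have eq2N : (- q) ^+ (2 * N) = q ^+ (2 * N) by rewrite !exprM sqrrN.
have -> : (2 * N.+1 = (2 * N).+2)%N by lia.
rewrite /psum !big_ord_recr /= -!/(psum _ _ _) mulrDr IHN -cc' ![_ ^+ (2 * N).+1]exprS eq2N -exprM.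
by ring.
Qed.

End SeriesInDisk.

Arguments tame_dominated {R a b b'} k m _ _ _.

(** * Theta functions as power series *)
Lemma altsign_square x : altsign (x ^+ 2) = altsign x.
Proof. by rewrite /altsign -signr_odd abszX oddX /= signr_odd. Qed.

Lemma square_countE n : square_count n = altsign n%:Z * signed_square_count n.
Proof.
rewrite /square_count /signed_square_count /fiber_sum mulr_fsumr; apply: eq_fsbigr => x.
move=> /set_mem[_ /= xn]; have -> : altsign n%:Z = altsign x.
  by rewrite -xn altsign_square.
by rewrite altsign_sqr.
Qed.

Lemma signed_square_count_bound n : `|signed_square_count n| <= 2.
Proof.
have [->|n0] := posnP n; first by rewrite signed_square_count0.
have [[s [s0 ->]]|nsq] := pselect (exists s, (0 < s)%N /\ n = (s ^ 2)%N).
  by rewrite signed_square_count_sqr// normrM normrX normrN1 expr1n.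
by rewrite signed_square_count_nonsqr// => s s0 ns; apply: nsq; exists s.
Qed.

Section Theta.
Variable R : realType.
Local Notation C := (R[i] : numFieldType).
Local Notation tame := (tame R).

Lemma tame_signed_square_count : tame signed_square_count.
Proof.
apply: (tame_dominated 2%N 0%N (tame_one R) (tame_one R)) => n.
by rewrite mul0r addr0 normr1 mulr1; exact: signed_square_count_bound.
Qed.

Lemma tame_square_count : tame square_count.
Proof.
apply: (tame_dominated 1%N 0%N tame_signed_square_count (tame_one R)) => n.
by rewrite square_countE mul0r addr0 mul1r normrM normrX normrN1 expr1n mul1r.
Qed.

(** The indices [x] and [- x] contribute equally, and no power of [q] occurs
    between two consecutive squares. *)
Lemma psum_square (q : C) N :
  psum square_count q (N.+1 ^ 2) = 2 * (\sum_(n < N.+1) q ^+ (n ^ 2)) - 1.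
Proof.
have gap m (M : nat) : (M <= (2 * m).+1)%N -> (0 < M)%N ->
    psum square_count q (m ^ 2 + M) = psum square_count q (m ^ 2).+1.
  elim: M => // M IHM mM _; have [->|M0] := posnP M; first by rewrite addn1.
  rewrite addnS /psum big_ord_recr /= -!/(psum _ _ _) IHM ?(ltnW mM)//.
  rewrite square_countE signed_square_count_nonsqr ?mulr0 ?mul0r ?addr0//; last by lia.
  move=> s s0 ms; have : (m < s < m.+1)%N; last by lia.
  by apply/andP; split; nia.
elim: N => [|N IHN].
  rewrite /psum !big_ord_recr !big_ord0 /= square_countE signed_square_count0 expr0.
  by rewrite mulr1 mulr1; ring.
rewrite (_ : N.+2 ^ 2 = N.+1 ^ 2 + (2 * N.+1).+1)%N; last by lia.
rewrite gap// big_ord_recr /= mulrDr addrAC -IHN /psum big_ord_recr /= -/(psum _ _ _).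
rewrite square_countE signed_square_count_sqr// mulrCA.
rewrite (_ : (N.+1 ^ 2)%N%:Z = N.+1%:Z ^+ 2); last by lia.
by rewrite altsign_square altsign_sqr mulr1.
Qed.

Lemma half_theta_cvg (q : C) : `|q| < 1 ->
  (fun N => \sum_(n < N) q ^+ (n ^ 2)) @ \oo --> (gf square_count q + 1) / 2.
Proof.
move=> q1; rewrite -cvg_shiftS.
have -> : [sequence \sum_(n < N.+1) q ^+ (n ^ 2)]_N =
    (fun N => (psum square_count q (N.+1 ^ 2) + 1) / 2).
  apply/funext => N /=; rewrite psum_square subrK mulrAC mulfV ?mul1r//.
  by rewrite pnatr_eq0.
apply: cvgMl; apply: cvgD; last exact: cvg_cst.
apply: (@cvg_subseq _ _ _ (fun N => N.+1 ^ 2)%N) => [n|]; first by nia.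
exact: gf_cvg tame_square_count q1.
Qed.

Lemma varphiE (q : C) : `|q| < 1 -> varphi q = gf square_count q.
Proof.
move=> q1; have h := half_theta_cvg q1; rewrite /varphi /bilateral_sum.
have -> : limn (fun N => \sum_(0 <= n < N) q ^ (Posz n ^+ 2)) = (gf square_count q + 1) / 2.
  apply/cvg_lim; [by []|apply: cvg_trans h; apply: near_eq_cvg]; near=> N.
  by rewrite big_mkord; apply: eq_bigr.
have -> : limn (fun N => \sum_(0 <= n < N) q ^ (Negz n ^+ 2)) = (gf square_count q + 1) / 2 - 1.
  apply/cvg_lim; first by [].
  have -> : (fun N => \sum_(0 <= n < N) q ^ (Negz n ^+ 2)) =
      (fun N => \sum_(n < N.+1) q ^+ (n ^ 2) - 1).
    apply/funext => N; rewrite big_mkord big_ord_recl /= expr0 addrC addKr.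
    by apply: eq_bigr => i _.
  have h1 := h; rewrite -cvg_shiftS in h1.
  exact: (cvgB h1 (cvg_cst _)).
by field.
Unshelve. all: by end_near. Qed.

Lemma varphiN (q : C) : `|q| < 1 -> varphi (- q) = gf signed_square_count q.
Proof.
move=> q1; have Nq1 : `|- q| < 1 by rewrite normrN.
rewrite (varphiE Nq1) /gf.
suff -> : psum square_count (- q) = psum signed_square_count q by [].
apply/funext => N.
apply: eq_bigr => i _; rewrite square_countE exprNn mulrA; congr (_ * _).
by rewrite rmorphM /altsign /= rmorphXn rmorphN1 mulrAC -expr2 sqrr_sign mul1r.
Qed.

(** Splitting the sum of [q^(n^2)] by the parity of [n] isolates
    [(2 k + 1)^2 = 8 (k (k + 1) / 2) + 1], so that the convergence of the series
    of [psi] follows from that of the series of [varphi]. *)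
Lemma psi_cvg (q : C) : `|q| < 1 -> q != 0 ->
  (fun N => \sum_(n < N) (q ^+ 8) ^+ ((n * n.+1) %/ 2)) @ \oo -->
    (gf square_count q - gf square_count (q ^+ 4)) / (2 * q).
Proof.
move=> q1 q0; have q41 : `|q ^+ 4| < 1 by rewrite normrX exprn_ilt1.
have -> : (gf square_count q - gf square_count (q ^+ 4)) / (2 * q) =
    ((gf square_count q + 1) / 2 - (gf square_count (q ^+ 4) + 1) / 2) / q.
  by move: (gf square_count q) (gf square_count (q ^+ 4)) => x y; field.
have -> : (fun N => \sum_(n < N) (q ^+ 8) ^+ ((n * n.+1) %/ 2)) =
    (fun N => (\sum_(n < 2 * N) q ^+ (n ^ 2) - \sum_(n < N) (q ^+ 4) ^+ (n ^ 2)) / q).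
  apply/funext => N; apply: (mulIf q0); rewrite divfK//.
  elim: N => [|N IHN]; first by rewrite !big_ord0 mul0r subr0.
  rewrite (_ : 2 * N.+1 = (2 * N).+2)%N; last by lia.
  rewrite !big_ord_recr /= mulrDl IHN -!exprM.
  rewrite (_ : (2 * N) ^ 2 = 4 * N ^ 2)%N; last by lia.
  rewrite (_ : (2 * N).+1 ^ 2 = (8 * ((N * N.+1) %/ 2)).+1)%N ?exprS; first by ring.
  have : (2 %| N * N.+1)%N by rewrite dvdn2 oddM /= andbN.
  by nia.
apply: cvgMl; apply: cvgB; last exact: half_theta_cvg.
apply: (@cvg_subseq _ (fun N => \sum_(n < N) q ^+ (n ^ 2)) _ (fun N => 2 * N)%N) => [n|].
  exact: leq_pmull.
exact: half_theta_cvg.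
Qed.

Lemma varphi_split (q : C) : `|q| < 1 ->
  varphi q = varphi (q ^+ 4) + 2 * q * psi (q ^+ 8).
Proof.
move=> q1; have q41 : `|q ^+ 4| < 1 by rewrite normrX exprn_ilt1.
have [->|q0] := eqVneq q 0; first by rewrite mulr0 mul0r addr0 expr0n.
have -> : psi (q ^+ 8) = (gf square_count q - gf square_count (q ^+ 4)) / (2 * q).
  apply/cvg_lim; [by []|apply: cvg_trans (psi_cvg q1 q0); apply: near_eq_cvg]; near=> N.
  by rewrite big_mkord.
rewrite (varphiE q1) (varphiE q41); move: (gf square_count q) (gf square_count (q ^+ 4)) => x y; by field.
Unshelve. all: by end_near. Qed.

Lemma varphi_sqr_even (q : C) : `|q| < 1 ->
  varphi q ^+ 2 + varphi (- q) ^+ 2 = 2 * varphi (q ^+ 2) ^+ 2.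
Proof.
move=> q1; have q21 : `|q ^+ 2| < 1 by rewrite normrX exprn_ilt1.
have Nq1 : `|- q| < 1 by rewrite normrN.
have t := tame_conv tame_square_count tame_square_count.
have sqrE (z : C) : `|z| < 1 -> varphi z ^+ 2 = gf (conv square_count square_count) z.
  by move=> z1; rewrite (varphiE z1) (gf_conv tame_square_count tame_square_count z1) expr2.
transitivity (gf (conv square_count square_count) q + gf (conv square_count square_count) (- q)).
  by congr (_ + _); exact: sqrE.
rewrite (gf_even t t q1 two_squares_double); congr (2 * _); symmetry; exact: sqrE.
Qed.

Lemma varphi0 : varphi (0 : C) = 1.
Proof.
have z1 : `|0 : C| < 1 by rewrite normr0.
rewrite (varphiE z1); apply: cvg_gf; apply: cvg_near_cst; near=> N.
have [M ->] : exists M, N = M.+1 by exists N.-1; rewrite prednK//; near: N; exists 1%N.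
rewrite /psum big_ord_recl /= expr0 mulr1 big1 ?addr0.
  by rewrite square_countE signed_square_count0.
by move=> i _; rewrite expr0n mulr0.
Unshelve. all: by end_near. Qed.

Lemma psi0 : psi (0 : C) = 1.
Proof.
apply/cvg_lim; [by []|apply: cvg_near_cst]; near=> N.
have [M ->] : exists M, N = M.+1 by exists N.-1; rewrite prednK//; near: N; exists 1%N.
rewrite big_mkord big_ord_recl /= expr0 big1 ?addr0// => i _.
rewrite expr0n (_ : (_ == 0)%N = false)//; apply/negbTE; rewrite -lt0n divn_gt0//.
Unshelve. all: by end_near. Qed.

End Theta.

(** * Algebraic relations between theta functions *)

(** The two functions are abstract here: every relation follows from
    [phi_split] and [phi_sqr_even]. *)
Section ThetaAlgebra.
Variables (K : numFieldType) (disk : K -> Prop) (phi psi : K -> K).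
Hypothesis diskN : forall q, disk q -> disk (- q).
Hypothesis diskX : forall q n, disk q -> disk (q ^+ n.+1).
Hypothesis disk_root8 : forall q, disk q -> exists2 t, disk t & t ^+ 8 = q.
Hypothesis phi0 : phi 0 = 1.
Hypothesis psi0 : psi 0 = 1.
Hypothesis phi_split : forall q, disk q -> phi q = phi (q ^+ 4) + 2 * q * psi (q ^+ 8).
Hypothesis phi_sqr_even : forall q, disk q ->
  phi q ^+ 2 + phi (- q) ^+ 2 = 2 * phi (q ^+ 2) ^+ 2.

Let two_neq0 : 2 != 0 :> K. Proof. by rewrite pnatr_eq0. Qed.

Lemma phiN_split q : disk q -> phi (- q) = phi (q ^+ 4) - 2 * q * psi (q ^+ 8).
Proof.
move=> dq; rewrite (phi_split (diskN dq)).
by rewrite (_ : (- q) ^+ 4 = q ^+ 4) 1?(_ : (- q) ^+ 8 = q ^+ 8); ring.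
Qed.

Lemma phi_sqr_split q : disk q ->
  phi (q ^+ 2) ^+ 2 = phi (q ^+ 4) ^+ 2 + 4 * q ^+ 2 * psi (q ^+ 8) ^+ 2.
Proof.
move=> dq; apply: (mulfI two_neq0).
by rewrite -(phi_sqr_even dq) (phi_split dq) (phiN_split dq); ring.
Qed.

(** Write the point as [t^8]. Comparing [phi_sqr_split] at [t] and at [t^2] with
    the square of [phi_split] at [t^2] leaves
    [4 t^2 psi (t^8) ^+ 2 = 4 t^2 phi (t^8) psi (t^16)]. *)
Lemma psi_sqr q : disk q -> psi q ^+ 2 = phi q * psi (q ^+ 2).
Proof.
move=> /disk_root8[t dt <-]; have [->|t0] := eqVneq t 0.
  by rewrite !expr0n /= phi0 psi0; ring.
have t20 : 4 * t ^+ 2 != 0 by rewrite mulf_neq0 ?expf_neq0 ?pnatr_eq0.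
have h1 := phi_sqr_split dt; have h2 := phi_sqr_split (diskX 1 dt).
have h3 := phi_split (diskX 1 dt).
rewrite -!exprM /= in h1 h2 h3 *; apply: (mulfI t20).
have -> : 4 * t ^+ 2 * psi (t ^+ 8) ^+ 2 = phi (t ^+ 2) ^+ 2 - phi (t ^+ 4) ^+ 2.
  by rewrite h1; ring.
by rewrite h2 h3; ring.
Qed.

Lemma phi_mulN q : disk q -> phi q * phi (- q) = phi (- (q ^+ 2)) ^+ 2.
Proof.
move=> dq; rewrite (phi_split dq) (phiN_split dq) (phiN_split (diskX 1 dq)) -!exprM /=.
have h2 := phi_sqr_split (diskX 1 dq); rewrite -!exprM /= in h2.
have h3 := psi_sqr (diskX 7 dq); rewrite -!exprM /= in h3.
transitivity (phi (q ^+ 4) ^+ 2 - 4 * q ^+ 2 * psi (q ^+ 8) ^+ 2); first by ring.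
by rewrite h2 h3; ring.
Qed.

Lemma phi_fourth_sub q : disk q ->
  phi q ^+ 4 - phi (- q) ^+ 4 = 16 * q * psi (q ^+ 2) ^+ 4.
Proof.
move=> dq; have h3 := psi_sqr (diskX 3 dq); have h4 := psi_sqr (diskX 1 dq).
rewrite -!exprM /= in h3 h4.
have -> : psi (q ^+ 2) ^+ 4 = phi (q ^+ 2) ^+ 2 * (phi (q ^+ 4) * psi (q ^+ 8)).
  by rewrite -h3 (exprM _ 2 2) h4 exprMn.
transitivity ((phi q ^+ 2 - phi (- q) ^+ 2) * (phi q ^+ 2 + phi (- q) ^+ 2)); first by ring.
rewrite (phi_sqr_even dq) (phi_split dq) (phiN_split dq); ring.
Qed.

End ThetaAlgebra.

(** With [a = phi ^+ 4] and [b = phiN ^+ 4], every quantity is a polynomial in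
    [a] and [b]: [16 q psi2 ^+ 4 = a - b], [phiN2 ^+ 8 = a b] and
    [16 q psi ^+ 8 = a (a - b)]. *)
Lemma eight_identities (K : numFieldType) (q phi phiN phiN2 psi psi2 E E2 P PN Q QN Q2 : K) :
  phi * phiN = phiN2 ^+ 2 -> psi ^+ 2 = phi * psi2 ->
  phi ^+ 4 - phiN ^+ 4 = 16 * q * psi2 ^+ 4 ->
  E = 2 * phi ^+ 4 - phiN ^+ 4 -> 2 * E2 = phi ^+ 4 + phiN ^+ 4 ->
  P - PN = phi ^+ 4 - phiN ^+ 4 ->
  Q = phiN ^+ 8 -> QN = phi ^+ 8 -> Q2 = phiN2 ^+ 8 ->
  [/\ Q = phiN ^+ 8, 16 * q * psi2 ^+ 4 + phi ^+ 4 = E,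
      2 * E2 + E = 3 * phi ^+ 4 & phi ^+ 4 * E + Q2 = 2 * phi ^+ 8] /\
  [/\ E - E2 = 24 * q * psi2 ^+ 4, P - PN = 16 * q * psi2 ^+ 4,
      Q - QN = 32 * q * (8 * q * psi2 ^+ 8 - psi ^+ 8) &
      E ^+ 2 - Q = 64 * q * psi ^+ 8].
Proof.
move=> h1 h2 h3 -> hE2 -> -> -> ->.
have psi8 : psi ^+ 8 = phi ^+ 4 * psi2 ^+ 4.
  by rewrite (exprM _ 2 4) h2 exprMn.
have N28 : phiN2 ^+ 8 = phi ^+ 4 * phiN ^+ 4.
  by rewrite (exprM _ 2 4) -h1 exprMn.
have two_neq0 : 2 != 0 :> K by rewrite pnatr_eq0.
have qpsi2 : 2 * (q * psi2 ^+ 8 * q) * 128 = (phi ^+ 4 - phiN ^+ 4) ^+ 2.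
  by rewrite h3; ring.
split; split=> //.
- by rewrite -h3; ring.
- by rewrite hE2; ring.
- by rewrite N28; ring.
- apply: (mulfI two_neq0).
  transitivity (2 * (2 * phi ^+ 4 - phiN ^+ 4) - 2 * E2); first by ring.
  rewrite hE2; transitivity (3 * (phi ^+ 4 - phiN ^+ 4)); first by ring.
  by rewrite h3; ring.
- transitivity (2 * (q * psi2 ^+ 8 * q) * 128 - 2 * (phi ^+ 4 * (16 * q * psi2 ^+ 4))).
    by rewrite qpsi2 -h3; ring.
  by rewrite psi8; ring.
- transitivity (4 * (phi ^+ 4 * (16 * q * psi2 ^+ 4))); first by rewrite -h3; ring.
  by rewrite psi8; ring.
Qed.

(** * The divisor series in terms of theta functions *)
Definition delta0 (n : nat) : int := (n == 0%N)%:Z.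

Lemma conv_signed_square_count_4 :
  conv (conv signed_square_count signed_square_count) (conv signed_square_count signed_square_count) =
  four_square_coef.
Proof.
apply/funext => n; rewrite -(four_square_formula (ltnSn n)) (exprM _ 2 2).
set F := \poly_(i < n.+1) signed_square_count i.
have F1 i : (i < n.+1)%N -> F`_i = (signed_square_count i)%:~R by move=> h; rewrite intz coef_poly h.
have F2 i : (i < n.+1)%N -> (F ^+ 2)`_i = (conv signed_square_count signed_square_count i)%:~R.
  by move=> h; exact: (coef_mul_trunc h F1 F1).
by rewrite [RHS](coef_mul_trunc (ltnSn n) F2 F2) intz.
Qed.

(** The coefficientwise form of [2 varphi q ^+ 4 - varphi (- q) ^+ 4 = calE q]. *)
Lemma four_square_hat_coef n :
  (2 * (-1) ^+ n - 1) * four_square_coef n = delta0 n + 24 * hat_coef n.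
Proof.
rewrite /four_square_coef /delta0 -signr_odd.
have [on|en] := boolP (odd n).
  by rewrite tau_odd// (_ : (n == 0%N) = false) /=; [ring|case: n on].
have nE : n = (2 * n./2)%N by rewrite mul2n even_halfK.
have tE : tau n = - 3 * hat_coef n by rewrite nE tau_double hat_coef_double.
by rewrite tE /=; ring.
Qed.

Lemma hat_coef_bound n : `|hat_coef n| <= `|tau n|.
Proof.
have [on|en] := boolP (odd n); first by rewrite tau_odd.
have -> : n = (2 * n./2)%N by rewrite mul2n even_halfK.
by rewrite tau_double hat_coef_double; lia.
Qed.

Lemma sum_divisors_le n : (0 < n)%N ->
  \sum_(d <- divisors n) d%:Z <= \sum_(i < n.+1) i%:Z.
Proof.
move=> n0; rewrite -(big_mkord xpredT (fun i => i%:Z)).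
rewrite [X in _ <= X](bigID (mem (divisors n))) /= -[X in _ <= X + _]big_filter.
apply: ler_wpDr; first by apply: sumr_ge0.
rewrite le_eqVlt; apply/orP; left; apply/eqP; apply: perm_big.
apply: uniq_perm; rewrite ?divisors_uniq ?filter_uniq ?iota_uniq// => d.
rewrite mem_filter mem_iota subn0 add0n ltnS /=.
by case dn: (d \in divisors n) => //=; rewrite -dvdn_divisors// in dn; rewrite dvdn_leq.
Qed.

(** The triple convolution of the constant sequence 1 grows quadratically and is
    summable in the disk by [tame_conv]. *)
Lemma tilde_coef_bound n :
  `|tilde_coef 1 n| <= `|conv (fun=> 1) (conv (fun=> 1) (fun=> 1)) n|.
Proof.
have -> : conv (fun=> 1) (conv (fun=> 1) (fun=> 1)) n = \sum_(i < n.+1) (i.+1)%:Z.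
  have conv11 m : conv (fun=> 1) (fun=> 1) m = m.+1%:Z.
    rewrite /conv; under eq_bigr do rewrite mulr1.
    by rewrite sumr_const card_ord natz.
  rewrite {1}/conv (reindex_inj rev_ord_inj) /=; apply: eq_bigr => i _.
  rewrite mul1r conv11; congr (Posz _.+1).
  by rewrite subSS subKn// -ltnS.
have [->|n0] := posnP n; first by rewrite /tilde_coef fiber_sum_divpairs0.
rewrite -sigma_tildeE// [X in _ <= X]ger0_norm; last by apply: sumr_ge0.
apply: (@le_trans _ _ (\sum_(i < n.+1) i%:Z)); last first.
  by apply: ler_sum => i _; lia.
rewrite /sigma_tilde; apply: le_trans (ler_norm_sum _ _ _) _.
under eq_bigr do rewrite normrM normrX normrN1 expr1n mul1r expr1.
exact: sum_divisors_le.
Qed.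

Lemma twisted_term (K : comNzRingType) (k : int) (z : K) n :
  ((2 * (-1) ^+ n - 1) * k)%:~R * z ^+ n =
  2 * (k%:~R * (- z) ^+ n) + (-1) * (k%:~R * z ^+ n).
Proof.
by rewrite (exprNn z) rmorphM rmorphB rmorphM rmorphXn rmorphN1 /=; ring.
Qed.

Section SigmaSeries.
Variable R : realType.
Local Notation C := (R[i] : numFieldType).

Lemma limn_from1 (u c : nat -> int) (q : C) : c 0%N = 0 ->
  (forall n, (0 < n)%N -> u n = c n) ->
  limn (fun N => \big[+%R/0]_(1 <= n < N) ((u n)%:~R * q ^+ n)) = gf c q.
Proof.
move=> c0 uc; rewrite /gf; suff -> : psum c q =
  (fun N => \big[+%R/0]_(1 <= n < N) ((u n)%:~R * q ^+ n)) by [].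
apply/funext => -[|N]; first by rewrite /psum big_ord0 big_geq.
rewrite /psum -(big_mkord xpredT (fun i => (c i)%:~R * q ^+ i)) big_ltn// c0 mul0r add0r.
by rewrite [LHS]big_nat [RHS]big_nat; apply: eq_bigr => n /andP[n0 _]; rewrite uc.
Qed.

Lemma calE_gf (q : C) : calE q = 1 + 24 * gf hat_coef q.
Proof. by rewrite /calE (limn_from1 _ (fiber_sum_divpairs0 _) sigma_hatE). Qed.

Lemma calP_gf (q : C) : calP q = 1 + 8 * gf (tilde_coef 1) q.
Proof. by rewrite /calP (limn_from1 _ (fiber_sum_divpairs0 _) (@sigma_tildeE 1)). Qed.

Lemma calQ_gf (q : C) : calQ q = 1 - 16 * gf (tilde_coef 3) q.
Proof. by rewrite /calQ (limn_from1 _ (fiber_sum_divpairs0 _) (@sigma_tildeE 3)). Qed.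

Lemma gf_delta0 (q : C) : gf delta0 q = 1.
Proof.
apply: cvg_gf; apply: cvg_near_cst; near=> N.
have [M ->] : exists M, N = M.+1 by exists N.-1; rewrite prednK//; near: N; exists 1%N.
by rewrite /psum big_ord_recl /= expr0 mulr1 big1 ?addr0// => i _; rewrite mul0r.
Unshelve. all: by end_near. Qed.

Lemma tame_four_square : tame R four_square_coef.
Proof.
have t := tame_conv (tame_signed_square_count R) (tame_signed_square_count R).
by rewrite -conv_signed_square_count_4; exact: (tame_conv t t).
Qed.

Lemma tame_tau : tame R tau.
Proof.
apply: (tame_dominated 1 1 tame_four_square (tame_one R)) => n.
by rewrite /four_square_coef; case: (n == _); lia.
Qed.

Lemma tame_hat_coef : tame R hat_coef.
Proof.
apply: (tame_dominated 1 0 tame_tau (tame_one R)) => n.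
by have := hat_coef_bound n; lia.
Qed.

Lemma varphiN_fourth (q : C) : `|q| < 1 -> varphi (- q) ^+ 4 = gf four_square_coef q.
Proof.
move=> q1; have ts := tame_signed_square_count R; have t := tame_conv ts ts.
by rewrite (varphiN q1) -conv_signed_square_count_4 (gf_conv t t q1) (gf_conv ts ts q1); ring.
Qed.

Lemma varphiN_fourth_tau (q : C) : `|q| < 1 -> varphi (- q) ^+ 4 = 1 - 8 * gf tau q.
Proof.
move=> q1; rewrite (varphiN_fourth q1).
have td : tame R delta0.
  by apply: (tame_dominated 1 0 (tame_one R) (tame_one R)) => n; rewrite /delta0; lia.
rewrite (@gf_linear _ four_square_coef delta0 tau 1 (-8) q q q td tame_tau)//.
  by rewrite gf_delta0 mulr1 mulNr.
by move=> n; rewrite /four_square_coef rmorphB rmorphM /=; ring.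
Qed.

Lemma calQE (q : C) : `|q| < 1 -> calQ q = varphi (- q) ^+ 8.
Proof.
move=> q1; rewrite calQ_gf.
rewrite (exprM _ 4 2) (varphiN_fourth_tau q1).
have tt := tame_conv tame_tau tame_tau.
rewrite (@gf_linear _ (tilde_coef 3) tau (conv tau tau) 1 (-4) q q q tame_tau tt)//.
  by rewrite (gf_conv tame_tau tame_tau q1); move: (gf tau q) => x; ring.
move=> n; rewrite (_ : tilde_coef 3 n = tau n - 4 * conv tau tau n).
  by rewrite rmorphB rmorphM /=; ring.
by rewrite conv_tau; ring.
Qed.

Lemma tame_tilde_coef1 : tame R (tilde_coef 1).
Proof.
have t := tame_conv (tame_one R) (tame_conv (tame_one R) (tame_one R)).
apply: (tame_dominated 1 0 t (tame_one R)) => n.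
by have := tilde_coef_bound n; lia.
Qed.

Lemma calEE (q : C) : `|q| < 1 -> calE q = 2 * varphi q ^+ 4 - varphi (- q) ^+ 4.
Proof.
move=> q1; have Nq1 : `|- q| < 1 by rewrite normrN.
rewrite calE_gf.
have td : tame R delta0.
  by apply: (tame_dominated 1 0 (tame_one R) (tame_one R)) => n; rewrite /delta0; lia.
have e1 : varphi q ^+ 4 = gf four_square_coef (- q).
  by have := varphiN_fourth Nq1; rewrite opprK.
pose c n := delta0 n + 24 * hat_coef n.
transitivity (gf c q).
  symmetry; rewrite (_ : 1 + _ = 1 * gf delta0 q + 24 * gf hat_coef q); last first.
    by rewrite gf_delta0 mulr1.
  apply: gf_linear => // [|n]; first exact: tame_hat_coef.
  by rewrite /c rmorphD rmorphM /=; ring.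
transitivity (2 * gf four_square_coef (- q) + (-1) * gf four_square_coef q); last first.
  rewrite mulN1r; congr (_ * _ - _); [exact: esym e1|exact: esym (varphiN_fourth q1)].
apply: gf_linear => //; try exact: tame_four_square.
by move=> n; rewrite /c -four_square_hat_coef; exact: twisted_term.
Qed.

Lemma calE_even (q : C) : `|q| < 1 -> calE q + calE (- q) = 2 * calE (q ^+ 2).
Proof.
move=> q1; rewrite !calE_gf.
have := gf_even tame_hat_coef tame_hat_coef q1 hat_coef_double.
move: (gf _ q) (gf _ (- q)) (gf _ (q ^+ 2)) => x y z e.
transitivity (2 + 24 * (x + y)); first by ring.
by rewrite e; ring.
Qed.

Lemma calP_odd (q : C) : `|q| < 1 ->
  calP q - calP (- q) = varphi q ^+ 4 - varphi (- q) ^+ 4.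
Proof.
move=> q1; have Nq1 : `|- q| < 1 by rewrite normrN.
rewrite !calP_gf.
have e0 : varphi q ^+ 4 = 1 - 8 * gf tau (- q).
  by have := varphiN_fourth_tau Nq1; rewrite opprK.
pose c n := if odd n then 2 * tau n else 0.
have odd_part (b : nat -> int) : tame R b -> (forall n, odd n -> b n = tau n) ->
    gf b q - gf b (- q) = gf c q.
  move=> tb b_tau; symmetry.
  rewrite (_ : gf b q - _ = 1 * gf b q + (-1) * gf b (- q)); last by rewrite mul1r mulN1r.
  apply: gf_linear => // n; rewrite /c (exprNn q) -signr_odd; case: ifP => on /=.
    by rewrite b_tau// rmorphM /=; ring.
  by ring.
have e1 := odd_part _ tame_tilde_coef1 (fun n on => esym (tau_odd_tilde_coef on)).
have e2 := odd_part _ tame_tau (fun n _ => erefl).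
transitivity ((1 - 8 * gf tau (- q)) - (1 - 8 * gf tau q)).
  move: e1 e2; move: (gf c q) (gf (tilde_coef 1) q) (gf (tilde_coef 1) (- q)) => x y z e1.
  move: (gf tau q) (gf tau (- q)) => v w e2.
  transitivity (8 * (y - z)); first by ring.
  by rewrite e1 -e2; ring.
by congr (_ - _); [exact: esym e0|exact: esym (varphiN_fourth_tau q1)].
Qed.

End SigmaSeries.

Theorem theorem2p4 (R : realType) (q : R[i]) (hq : `|q| < 1) :
  [/\ calQ q = varphi (- q) ^+ 8,
      16 * q * psi (q ^+ 2) ^+ 4 + varphi q ^+ 4 = calE q,
      2 * calE (q ^+ 2) + calE q = 3 * varphi q ^+ 4 &
      varphi q ^+ 4 * calE q + calQ (q ^+ 2) = 2 * varphi q ^+ 8] /\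
  [/\ calE q - calE (q ^+ 2) = 24 * q * psi (q ^+ 2) ^+ 4,
      calP q - calP (- q) = 16 * q * psi (q ^+ 2) ^+ 4,
      calQ q - calQ (- q)
        = 32 * q * (8 * q * psi (q ^+ 2) ^+ 8 - psi q ^+ 8) &
      calE q ^+ 2 - calQ q = 64 * q * psi q ^+ 8].
Proof.
pose disk (z : R[i]) : Prop := `|z| < 1.
have diskN z : disk z -> disk (- z) by rewrite /disk normrN.
have diskX z n : disk z -> disk (z ^+ n.+1).
  by move=> z1; rewrite /disk normrX exprn_ilt1.
have root8 z : disk z -> exists2 t, disk t & t ^+ 8 = z.
  move=> z1; pose t := sqrtc (sqrtc (sqrtc z)).
  have tz : t ^+ 8 = z by rewrite (exprM _ 2 4) sqr_sqrtc (exprM _ 2 2) !sqr_sqrtc.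
  by exists t => //; move: z1; rewrite /disk -tz normrX expr_lt1.
have hsplit := @varphi_split R; have heven := @varphi_sqr_even R.
have p0 := varphi0 R; have s0 := psi0 R.
apply: (@eight_identities _ q _ _ (varphi (- (q ^+ 2)))).
- exact: (phi_mulN diskN diskX root8 p0 s0 hsplit heven hq).
- exact: (psi_sqr diskN diskX root8 p0 s0 hsplit heven hq).
- exact: (phi_fourth_sub diskN diskX root8 p0 s0 hsplit heven hq).
- exact: calEE.
- rewrite -(calE_even hq) (calEE hq) (calEE (diskN _ hq)) opprK.
  by move: (varphi q) (varphi (- q)) => x y; ring.
- exact: calP_odd.
- exact: calQE.
- by rewrite (calQE (diskN _ hq)) opprK.
- exact: (calQE (diskX _ 1 hq)).
Qed.
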